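(* Let $K$ be a field, $R=K[x_1,\ldots,x_n]$, and let $I\subset R$ be a matroidal ideal of degree $d$ with $\gcd(I)=1$ and $\operatorname{supp}(I)=\{x_1,\ldots,x_n\}$. Then $$\operatorname{astab}(I)\le \min\{d,\ell(I)\}\quad\text{and}\quad \operatorname{dstab}(I)\leq \min\{d,\ell(I)\}.$$
   Context: For a monomial ideal $I$, $G(I)$ denotes its unique minimal set of monomial generators; $\deg_{x_i}(u)$ is the exponent of $x_i$ in the monomial $u$; $\operatorname{supp}(u)$ is the set of variables dividing $u$; $\operatorname{supp}(I)=\bigcup_{u\in G(I)}\operatorname{supp}(u)$; $\gcd(I)$ is the greatest common divisor of the elements of $G(I)$. A monomial ideal $I$ generated in a single degree is polymatroidal if for all $u,v\in G(I)$ with $\deg_{x_i}(u)>\deg_{x_i}(v)$ there is an index $j$ with $\deg_{x_j}(v)>\deg_{x_j}(u)$ and $x_j(u/x_i)\in G(I)$. A matroidal ideal is a square-free polymatroidal ideal; its degree is the common degree of the elements of $G(I)$. $\operatorname{Ass}(I)$ denotes the set of associated primes of $R/I$. $\operatorname{astab}(I)$ is the smallest integer $l\ge 1$ with $\operatorname{Ass}(I^t)=\operatorname{Ass}(I^l)$ for all $t\ge l$, and $\operatorname{dstab}(I)$ is the smallest integer $k\ge1$ with $\operatorname{depth} R/I^s=\operatorname{depth} R/I^k$ for all $s\ge k$ (both exist by results of Brodmann). $\ell(I)$ is the analytic spread of $I$, i.e. the Krull dimension of $\bigoplus_{k\ge0} I^k/\mathfrak{m}I^k$, where $\mathfrak{m}=(x_1,\ldots,x_n)$.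 *)

(* Defs.v *)
From HB Require Import structures.
From mathcomp Require Import all_boot all_order all_algebra ring_quotient.
From mathcomp Require Import mpoly.
From mathcomp Require Import boolp classical_sets constructive_ereal.

Set Implicit Arguments.
Unset Strict Implicit.
Unset Printing Implicit Defensive.

Import Order.TTheory GRing.Theory Num.Theory.

Local Open Scope classical_set_scope.
Local Open Scope ring_scope.

(* Numerical invariants take values in [\bar int] (natural numbers together
   with [+oo]).  No finiteness is built in: [inf_nat] is [+oo] when no number
   has the property, and [sup_nat] is [+oo] when there are arbitrarily large
   ones ([-oo] when there are none; see [inf_nat_least], [inf_nat0], [sup_nat_greatest],
   [sup_nat_unbounded] below). *)
Definition natE (k : nat) : \bar int := (k%:Z)%:E.

Definition inf_nat (P : set nat) : \bar int := infimum +oo%E (natE @` P).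

Definition sup_nat (P : set nat) : \bar int := supremum -oo%E (natE @` P).

Section Ideals.
Variable A : comNzRingType.
Implicit Types (S I J P : set A) (x : A).

Definition ideal_gen S : set A :=
  [set x | exists2 s : seq (A * A),
     (forall p, p \in s -> S p.2) & x = \sum_(p <- s) p.1 * p.2].

Definition ideal_mul I J : set A :=
  ideal_gen [set x | exists2 a, I a & exists2 b, J b & x = a * b].

Fixpoint ideal_pow I (k : nat) : set A :=
  if k is k'.+1 then ideal_mul I (ideal_pow I k') else setT.

Definition prime_ideal P : Prop :=
  idealr_closed [pred x | x \in P] /\ prime_idealr_closed [pred x | x \in P].

(* Associated primes of the module A/J: the primes that are annihilators of
   the class of some f. *)
Definition Ass J : set (set A) :=
  [set P | prime_ideal P /\ exists f, P = [set g | J (g * f)]].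

(* A/J-regular sequences; the last clause says that A/(J + (fs)) is nonzero. *)
Fixpoint regular_seq J (fs : seq A) : Prop :=
  if fs is f :: fs' then
    (forall g, J (f * g) -> J g) /\ regular_seq (ideal_gen (J `|` [set f])) fs'
  else ~ J 1.

Definition krull_dim : \bar int :=
  sup_nat [set l | exists P : nat -> set A,
    (forall i, (i <= l)%N -> prime_ideal (P i)) /\
    (forall i, (i < l)%N -> P i `<` P i.+1)].

Lemma ideal_gen0 S : ideal_gen S 0.
Proof. by exists [::]; rewrite ?big_nil. Qed.

Lemma ideal_genD S x y : ideal_gen S x -> ideal_gen S y -> ideal_gen S (x + y).
Proof.
move=> [s Ss ->] [t St ->]; exists (s ++ t); last by rewrite big_cat.
by move=> p; rewrite mem_cat => /orP[/Ss|/St].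
Qed.

Lemma ideal_genM S a x : ideal_gen S x -> ideal_gen S (a * x).
Proof.
move=> [s Ss ->]; exists [seq (a * p.1, p.2) | p <- s].
  by move=> _ /mapP[p /Ss Sp ->].
by rewrite big_map mulr_sumr; apply: eq_bigr => p _; rewrite mulrA.
Qed.

Lemma sub_ideal_gen S : S `<=` ideal_gen S.
Proof.
move=> x Sx; exists [:: (1, x)]; last by rewrite big_seq1 mul1r.
by move=> p; rewrite inE => /eqP->.
Qed.

Lemma ideal_gen_min S J : J 0 -> (forall x y, J x -> J y -> J (x + y)) ->
  (forall a x, J x -> J (a * x)) -> S `<=` J -> ideal_gen S `<=` J.
Proof.
move=> J0 JD JM SJ x [s Ss ->]; rewrite big_seq.
by apply: (big_ind J) => // p /Ss/SJ; apply: JM.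
Qed.

Lemma ideal_pow0 I k : ideal_pow I k 0.
Proof. by case: k => [|k] //; apply: ideal_gen0. Qed.

Lemma ideal_powD I k x y :
  ideal_pow I k x -> ideal_pow I k y -> ideal_pow I k (x + y).
Proof. by case: k => [|k] //; apply: ideal_genD. Qed.

Lemma ideal_powM I k a x : ideal_pow I k x -> ideal_pow I k (a * x).
Proof. by case: k => [|k] //; apply: ideal_genM. Qed.

Lemma ideal_pow_mul I k l x y :
  ideal_pow I k x -> ideal_pow I l y -> ideal_pow I (k + l) (x * y).
Proof.
elim: k x => [|k IHk] x Ix Iy; first exact: ideal_powM.
move: x Ix; apply: ideal_gen_min => [|x z|a x|_ [a Ia [b Ib ->]]].
- by rewrite mul0r; apply: ideal_pow0.
- by rewrite mulrDl; apply: ideal_powD.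
- by rewrite -mulrA; apply: ideal_powM.
rewrite -mulrA; apply: sub_ideal_gen.
by exists a => //; exists (b * y) => //; apply: IHk.
Qed.

(* The Rees algebra (+)_k I^k, realized as the subring of A[t] of the
   polynomials whose coefficient of t^k lies in I^k. *)
Definition rees I : {pred {poly A}} :=
  fun p => `[< forall k, ideal_pow I k p`_k >].

Lemma rees_subring_closed I : subring_closed (rees I).
Proof.
have opp p : p \in rees I -> - p \in rees I.
  by move=> /asboolP Ip; apply/asboolP=> k; rewrite coefN -mulN1r; apply: ideal_powM.
split.
- apply/asboolP=> -[|k] //; rewrite coef1; exact: ideal_pow0.
- move=> p q /asboolP Ip /opp/asboolP Iq; apply/asboolP=> k.
  by rewrite coefD; apply: ideal_powD.
move=> p q /asboolP Ip /asboolP Iq; apply/asboolP=> k; rewrite coefM.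
apply: (big_ind (ideal_pow I k)) => [||i _]; first exact: ideal_pow0.
  exact: ideal_powD.
by rewrite -{1}(subnKC (ltnSE (ltn_ord i))); apply: ideal_pow_mul.
Qed.

HB.instance Definition _ I :=
  GRing.isSubringClosed.Build {poly A} (rees I) (rees_subring_closed I).

Record rees_alg I := ReesAlg { rees_val : {poly A}; _ : rees_val \in rees I }.

HB.instance Definition _ I := [isSub for @rees_val I].
HB.instance Definition _ I := [Choice of rees_alg I by <:].
HB.instance Definition _ I :=
  [SubChoice_isSubComNzRing of rees_alg I by <:].

End Ideals.

Section Polynomials.
Variables (K : fieldType) (n : nat).
Local Notation R := {mpoly K[n]}.
Implicit Types (I J : set R) (u v w : 'X_{1..n}) (S : set 'X_{1..n}).

Definition irrelevant : set R := ideal_gen (range (fun i : 'I_n => 'X_i : R)).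

(* [depth J] is the depth of R/J with respect to the irrelevant maximal ideal. *)
Definition depth J : \bar int :=
  sup_nat [set r | exists fs : seq R,
    [/\ size fs = r, forall f, f \in fs -> irrelevant f & regular_seq J fs]].

(* The ideal (+)_k m I^k of the Rees algebra, whose quotient is the fiber ring
   (+)_k I^k / m I^k. *)
Definition rees_m I : {pred rees_alg I} :=
  fun p => `[< forall k,
     ideal_mul irrelevant (ideal_pow I k) (rees_val p)`_k >].
Arguments rees_m I _ : clear implicits.

Lemma irrelevant_coef0 (x : R) : irrelevant x -> x@_0%MM = 0.
Proof.
move: x; apply: ideal_gen_min => [|x y|a x|_ [i _ <-]].
- by rewrite mcoeff0.
- by rewrite mcoeffD => -> ->; rewrite addr0.
- by rewrite mcoeff0_is_multiplicative => ->; rewrite mulr0.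
- by rewrite mcoeffX mnm1_eq0.
Qed.

Lemma ideal_mulM I J k l x y : ideal_pow I k x ->
  ideal_mul J (ideal_pow I l) y -> ideal_mul J (ideal_pow I (k + l)) (x * y).
Proof.
move=> Ix; move: y; apply: ideal_gen_min => [|y z|a y|_ [a Ja [b Ib ->]]].
- by rewrite mulr0; apply: ideal_gen0.
- by rewrite mulrDr; apply: ideal_genD.
- by rewrite mulrCA; apply: ideal_genM.
rewrite mulrCA; apply: sub_ideal_gen.
by exists a => //; exists (x * b) => //; apply: ideal_pow_mul.
Qed.

Lemma rees_m_idealr_closed I : idealr_closed (rees_m I).
Proof.
split.
- by apply/asboolP=> k; rewrite coef0; apply: ideal_gen0.
- apply/negP => /asboolP /(_ 0%N); rewrite coef1 /= => m1.
  suff /irrelevant_coef0 : irrelevant 1 by apply/eqP; rewrite mcoeff1 eqxx oner_neq0.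
  move: m1; apply: ideal_gen_min => [||a x|_ [a ma [b _ ->]]].
  + exact: ideal_gen0.
  + exact: ideal_genD.
  + exact: ideal_genM.
  + by rewrite mulrC; apply: ideal_genM.
move=> a p q /asboolP mp /asboolP mq; apply/asboolP => k.
rewrite (_ : rees_val _ = rees_val a * rees_val p + rees_val q) // coefD.
apply: ideal_genD; last exact: mq.
rewrite coefM.
have /asboolP Ia := valP a.
apply: (big_ind (ideal_mul _ _)) => [||i _]; first exact: ideal_gen0.
  exact: ideal_genD.
by rewrite -{1}(subnKC (ltnSE (ltn_ord i))); apply: ideal_mulM.
Qed.

HB.instance Definition _ I :=
  isIdealr.Build (rees_alg I) (rees_m I) (rees_m_idealr_closed I).

Definition fiber_ring I : comNzRingType := {ideal_quot (rees_m I)}.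

Definition analytic_spread I : \bar int := krull_dim (fiber_ring I).

Definition astab I : \bar int :=
  inf_nat [set l | (1 <= l)%N /\
    forall t, (l <= t)%N -> Ass (ideal_pow I t) = Ass (ideal_pow I l)].

Definition dstab I : \bar int :=
  inf_nat [set k | (1 <= k)%N /\
    forall s, (k <= s)%N -> depth (ideal_pow I s) = depth (ideal_pow I k)].

Definition monomials S : set R := (fun u => 'X_[u] : R) @` S.

Definition monomial_ideal I : Prop := exists S, I = ideal_gen (monomials S).

(* G(I), as a set of exponent vectors: the monomials of I that are minimal for
   divisibility (see [min_gens_gen] and [min_gens_least]). *)
Definition min_gens I : set 'X_{1..n} :=
  [set u | I 'X_[u] /\ forall v, I 'X_[v] -> (v <= u)%MM -> v = u].

Definition gens_degree I (d : nat) : Prop :=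
  forall u, min_gens I u -> mdeg u = d.

Definition polymatroidal I : Prop :=
  [/\ monomial_ideal I, exists d, gens_degree I d &
      forall u v, min_gens I u -> min_gens I v ->
      forall i, (v i < u i)%N ->
      exists2 j, (u j < v j)%N & min_gens I (u - U_(i) + U_(j))%MM].

Definition squarefree I : Prop :=
  forall u, min_gens I u -> forall i, (u i <= 1)%N.

Definition matroidal I : Prop := polymatroidal I /\ squarefree I.

(* The monomial w is the greatest common divisor of G(I). *)
Definition gcd_gens I w : Prop :=
  (forall u, min_gens I u -> (w <= u)%MM) /\
  (forall v, (forall u, min_gens I u -> (v <= u)%MM) -> (v <= w)%MM).

Definition supp I : set 'I_n :=
  \bigcup_(u in min_gens I) [set i | (0 < u i)%N].

Lemma mem_monomial_ideal S (x : R) u : ideal_gen (monomials S) x ->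
  u \in msupp x -> exists2 v, S v & (v <= u)%MM.
Proof.
pose J : set R := [set y : R | forall w, w \in msupp y -> exists2 v, S v & (v <= w)%MM].
move=> Sx; suff /(_ x Sx u) : ideal_gen (monomials S) `<=` J by [].
apply: ideal_gen_min => [w|y z Jy Jz w|a y Jy w|_ [v Sv <-] w].
- by rewrite msupp0.
- by move=> /msuppD_le; rewrite mem_cat => /orP[/Jy|/Jz].
- move=> /msuppM_le /allpairsP[[w1 w2] /= [_ /Jy[v Sv vw] ->]].
  exists v => //; apply: (lepm_trans vw); exact: lem_addl.
- by rewrite msuppX inE => /eqP->; exists v => //; apply: lepm_refl.
Qed.

Lemma min_gens_least I S : I = ideal_gen (monomials S) -> min_gens I `<=` S.
Proof.
move=> -> u [Iu minu].
have [|v Sv vu] := mem_monomial_ideal Iu (u := u); first by rewrite msuppX inE.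
by rewrite -(minu v) //; apply: sub_ideal_gen; exists v.
Qed.

Lemma min_gens_gen I :
  monomial_ideal I -> I = ideal_gen (monomials (min_gens I)).
Proof.
move=> [S defI].
have I0 : I 0 by rewrite defI; apply: ideal_gen0.
have ID x y : I x -> I y -> I (x + y) by rewrite defI; apply: ideal_genD.
have IM a x : I x -> I (a * x) by rewrite defI; apply: ideal_genM.
apply/seteqP; split; last first.
  by apply: ideal_gen_min => // _ [u [Iu _] <-].
rewrite [X in X `<=` _]defI; apply: ideal_gen_min => [|x y|a x|_ [u Su <-]].
- exact: ideal_gen0.
- exact: ideal_genD.
- exact: ideal_genM.
have : I 'X_[u] by rewrite defI; apply: sub_ideal_gen; exists u.
have [k] := ubnP (mdeg u); elim: k u {Su} => // k IHk u ltuk Iu.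
have [minu|] := pselect (forall v, I 'X_[v] -> (v <= u)%MM -> v = u).
  by apply: sub_ideal_gen; exists u.
move=> /existsNP[v /not_implyP[Iv /not_implyP[vu neq]]].
rewrite -(submK vu) mpolyXD; apply: ideal_genM; apply: IHk => //.
rewrite -ltnS; apply: leq_trans ltuk; rewrite ltnS -{1}(submK vu) mdegD.
rewrite -[X in (X < _)%N]add0n ltn_add2r lt0n mdeg_eq0.
by apply/eqP => uv0; apply: neq; rewrite -[RHS](submK vu) uv0 add0m.
Qed.

End Polynomials.

Lemma le_natE (a b : nat) : (natE a <= natE b)%E = (a <= b)%N.
Proof. by []. Qed.

Lemma inf_nat0 : inf_nat set0 = +oo%E.
Proof. by rewrite /inf_nat image_set0 /infimum eqxx. Qed.

Lemma infimumE (x0 y : \bar int) (B : set (\bar int)) :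
  B !=set0 -> infimums B y -> infimum x0 B = y.
Proof.
move=> /set0P B0 By; rewrite /infimum (negbTE B0).
case: xgetP => [z -> Bz|/(_ y)]//; exact: is_subset1_infimums Bz By.
Qed.

Lemma supremumE (x0 y : \bar int) (B : set (\bar int)) :
  B !=set0 -> supremums B y -> supremum x0 B = y.
Proof.
move=> /set0P B0 By; rewrite /supremum (negbTE B0).
case: xgetP => [z -> Bz|/(_ y)]//; exact: is_subset1_supremums Bz By.
Qed.

Lemma inf_nat_least (P : set nat) a :
  P a -> (forall b, P b -> (a <= b)%N) -> inf_nat P = natE a.
Proof.
move=> Pa mina; apply: infimumE; first by exists (natE a), a.
split=> [_ [b /mina ab <-]|y yP]; first by rewrite le_natE.
by apply: yP; exists a.
Qed.

Lemma sup_nat_greatest (P : set nat) a :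
  P a -> (forall b, P b -> (b <= a)%N) -> sup_nat P = natE a.
Proof.
move=> Pa maxa; apply: supremumE; first by exists (natE a), a.
split=> [_ [b /maxa ab <-]|y yP]; first by rewrite le_natE.
by apply: yP; exists a.
Qed.

Lemma sup_nat_unbounded (P : set nat) :
  (forall a, exists2 b, P b & (a <= b)%N) -> sup_nat P = +oo%E.
Proof.
move=> unb; have [b0 Pb0 _] := unb 0%N; apply: supremumE.
  by exists (natE b0); exists b0.
split=> [_ [b _ <-] //|[y||] yP //]; last first.
  exact: (yP _ (ex_intro2 _ _ b0 Pb0 erefl)).
have [b Pb yb] := unb `|y|%N.+1; have := yP _ (ex_intro2 _ _ b Pb erefl).
rewrite lee_fin => by_; suff : y < b%:Z by rewrite ltNge by_.
by apply: (le_lt_trans (ler_norm y)); rewrite -abszE ltz_nat.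
Qed.

(* Main.v *)
Require Import Defs.
From HB Require Import structures.
From mathcomp Require Import all_boot all_order all_algebra ring_quotient.
From mathcomp Require Import mpoly zify ring.
From mathcomp Require Import boolp classical_sets constructive_ereal.
Import mathcomp.boot.fintype mathcomp.boot.finset.

(** The generators of [I] are the bases of a matroid of rank [d] on the
    variables; [gcd_gens] and [supp] say that it has neither coloops nor loops.
    A monomial lies in [I^t] exactly when it is a multiple of a product of [t]
    bases ([ideal_powE]).

    The minimum is [d].  Fix a basis [B0] and let [S] run through the initial
    segments of an enumeration of [B0].  The bases that contain [S] are the
    vertices of a face of the base polytope, and each face gives a prime of the
    fiber ring, the kernel of the projection onto the monomials of that face.
    Since there are no coloops, one exchange turns [B0] into a basis that
    contains [S] but not the next element, so the chain of faces is strict and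
    [analytic_spread I >= d] ([analytic_spread_ge]).  It remains to see that
    associated primes and depth are constant from the exponent [d] on.

    Everything rests on the fundamental graph of a basis [B], with an edge
    between [x] in [B] and [y] outside [B] when [B - x + y] is a basis.
    A union of components of this graph meets all bases in the same number of
    elements, and bases can be recombined freely across such a union
    ([unlinked_card], [unlinked_combine]).  On the other hand, on a connected
    piece [C] that meets [B] there is a monomial [w] such that [w * x_i] is a
    product of [#|B & C|] bases for every [i] in [C], while [w] itself has one
    variable of [C] too few ([linked_socle]).

    Associated primes.  An associated prime of a monomial ideal is generated by
    variables and is the annihilator of a monomial ([Ass_mon_ideal]).  The prime
    of the variables in [A] is associated to some power of [I] only if the
    contraction of the matroid to [A] is connected and has no loop, by
    recombination; and in that case [w] shows that it is associated to [I^t]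
    for all [t >= d].

    Depth.  For [t >= d] the depth of [R/I^t] is [c - 1], where [c] is the
    number of components of the fundamental graph ([depth_pow]).  The
    differences [x_a0 - x_a] of representatives of the components form a
    regular sequence ([regular_seq_exists]).  No regular sequence is longer:
    a regular sequence of length [r] forces a Koszul-type complex of
    [R/I^t] to be exact in degrees below [r] ([cocycle_is_coboundary]), but the
    product over all components of the monomials [w] carries a cocycle
    of degree [c - 1] that is not a coboundary ([regular_seq_bound]). *)

Set Implicit Arguments.
Unset Strict Implicit.
Unset Printing Implicit Defensive.

Import Order.TTheory GRing.Theory Num.Theory.

(** * Exchange of bases *)

Ltac card_lia :=
  clear; repeat match goal with |- context [#|?S|] => move: #|S| => ? end;
  repeat match goal with |- context [?x \in ?S] => case: (x \in S) end; lia.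

Section Exchange.
Variables (T : finType) (Bs : {set {set T}}).

Definition exchange := forall B B', B \in Bs -> B' \in Bs ->
  forall x, x \in B -> x \notin B' ->
  exists y, [/\ y \in B', y \notin B & y |: B :\ x \in Bs].

(** The bases that meet [A] in as few elements as possible: their traces on
    [A] are the bases of the contraction of the matroid to [A]. Working with
    them inside the given matroid avoids constructing contractions. *)
Definition minimal (A B : {set T}) :=
  B \in Bs /\ forall B', B' \in Bs -> #|B :&: A| <= #|B' :&: A|.

(** The edges of the fundamental graph of [B], oriented from [B] to its
    complement. *)
Definition edge (B : {set T}) (x y : T) :=
  [&& x \in B, y \notin B & y |: B :\ x \in Bs].

Definition unlinked (B C D : {set T}) :=
  forall x y, x \in C -> y \in D -> ~~ edge B x y /\ ~~ edge B y x.

Lemma card_swap (A B : {set T}) x y : x \in B -> y \notin B ->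
  #|(y |: B :\ x) :&: A| + (x \in A) = #|B :&: A| + (y \in A).
Proof.
move=> xB yB; have xy : y != x by apply: contraNneq yB => ->.
rewrite (cardsD1 y) (cardsD1 x (B :&: A)) !inE eqxx xB /=.
suff -> : (y |: B :\ x) :&: A :\ y = (B :&: A) :\ x by card_lia.
apply/setP => z; rewrite !inE; case: (eqVneq z y) => [->|] /=.
  by rewrite (negbTE yB) andbF.
by move=> _; rewrite andbA.
Qed.

Lemma swap_closer (B B' : {set T}) x y : x \in B -> x \notin B' -> y \in B' ->
  #|(y |: B :\ x) :\: B'| < #|B :\: B'|.
Proof.
move=> xB xB' yB'; apply/proper_card/properP; split.
  apply/subsetP => z; rewrite !inE => /andP[zB' /orP[/eqP zy|/andP[_ ->]]].
    by rewrite zy yB' in zB'.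
  by rewrite zB'.
exists x; rewrite !inE ?xB ?xB' // eqxx /= orbF.
by apply: contraNneq xB' => ->.
Qed.

Lemma card_lt_witness (S S' : {set T}) : #|S'| < #|S| -> exists2 x, x \in S & x \notin S'.
Proof.
move=> lt; apply/subsetPn; apply/negP => /subset_leq_card; lia.
Qed.

Hypothesis exch : exchange.
Implicit Types A B C D : {set T}.

(** Contracting: the trace on [A] of any basis contains a basis of the
    contraction. A basis [B] of smallest trace inside the given one is minimal
    because, among the bases with a smaller trace than [B], the one closest to
    [B] has its trace inside that of [B]. *)
Lemma minimal_below A B' : B' \in Bs ->
  exists2 B, minimal A B & B :&: A \subset B' :&: A.
Proof.
move=> B'b.
pose P (B : {set T}) := (B \in Bs) && (B :&: A \subset B' :&: A).
have PB' : P B' by rewrite /P B'b subxx.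
have [B /andP[Bb subB] minB] := arg_minnP (fun B : {set T} => #|B :&: A|) PB'.
exists B => //; split=> // B2; have [k] := ubnP #|B2 :\: B|.
elim: k B2 => // k IHk B2 ltk B2b; rewrite leqNgt; apply/negP => lt.
have [x|none] := pickP [pred x in B2 :\: B | x \in A].
  rewrite !inE => /andP[/andP[xB xB2] xA].
  have [y [yB yB2 B3b]] := exch B2b Bb xB2 xB.
  have := IHk _ (leq_trans (swap_closer xB2 xB yB) ltk) B3b.
  have := card_swap A xB2 yB2; rewrite xA; move: lt; card_lia.
suff sub2 : B2 :&: A \subset B :&: A.
  by have := minB B2; rewrite /P B2b (subset_trans sub2 subB) => /(_ isT); move: lt; card_lia.
apply/subsetP => z; rewrite !inE => /andP[zB2 zA]; rewrite zA andbT.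
by have := none z; rewrite !inE zB2 zA /= !andbT => /negbFE.
Qed.

Lemma minimal_card A B B' : minimal A B -> minimal A B' -> #|B :&: A| = #|B' :&: A|.
Proof. by move=> [Bb minB] [B'b minB']; apply/eqP; rewrite eqn_leq minB // minB'. Qed.

(** An exchange that removes an element of [A] from a minimal basis has to
    bring one in. *)
Lemma minimal_swap A B x y : minimal A B -> x \in B -> x \in A -> y \notin B ->
  y |: B :\ x \in Bs -> y \in A /\ minimal A (y |: B :\ x).
Proof.
move=> [Bb minB] xB xA yB swb; have := card_swap A xB yB; have := minB _ swb.
rewrite xA; case: (y \in A); last by card_lia.
by rewrite !addn1 => _ [eqc]; split=> //; split=> // B' /minB; rewrite eqc.
Qed.

Lemma card_split (A C S : {set T}) : C \subset A ->
  #|S :&: A| = #|S :&: C| + #|S :&: (A :\: C)|.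
Proof.
by move=> CA; rewrite -{1}(setIidPr CA) setIDA setIA cardsID.
Qed.

(** A counterexample [B'] closest to [B] loses its excess on [C] in every
    exchange towards [B] at an element of [A], so its elements of [A] outside
    [B] all lie in [C]. As the traces on [A] have the same size, [B'] lacks
    some element of [B] in [A - C]; exchanging it out of [B] yields an edge of
    the fundamental graph between [A - C] and [C]. *)
Lemma unlinked_card_le A B C B' : minimal A B -> C \subset A ->
  unlinked B C (A :\: C) -> minimal A B' -> #|B' :&: C| <= #|B :&: C|.
Proof.
move=> mB CA unl; have [k] := ubnP #|B' :\: B|.
elim: k B' => // k IHk B' ltk mB'; rewrite leqNgt; apply/negP => lt.
have Bb := mB.1; have B'b := mB'.1.
have tot := minimal_card mB mB'; rewrite !(card_split _ CA) in tot.
have step x : x \in B' -> x \notin B -> x \in A -> 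
    exists2 y, y \in A & #|B' :&: C| + (y \in C) <= #|B :&: C| + (x \in C).
  move=> xB' xB xA; have [y [yB yB' swb]] := exch B'b Bb xB' xB.
  have [yA msw] := minimal_swap mB' xB' xA yB' swb; exists y => //.
  have := IHk _ (leq_trans (swap_closer xB' xB yB) ltk) msw.
  by have := card_swap C xB' yB'; card_lia.
have [x] := card_lt_witness lt; rewrite !inE => /andP[xB' xC]; rewrite xC andbT => xB.
have [y _] := step x xB' xB (subsetP CA _ xC); rewrite xC => le1.
have [|z] := @card_lt_witness (B :&: (A :\: C)) (B' :&: (A :\: C)).
  by move: le1 tot lt; card_lia.
rewrite !inE => /andP[zB /andP[zC zA]]; rewrite zC zA !andbT => zB'.
have [u [uB' uB swb]] := exch Bb B'b zB zB'.
have [uA _] := minimal_swap mB zB zA uB swb.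
(* Exchanging u out of B' would otherwise keep the excess on C. *)
have uC : u \in C.
  apply/negPn/negP => uC; have [v _] := step u uB' uB uA.
  by rewrite (negbTE uC); move: lt; card_lia.
have [] := unl u z uC _; first by rewrite !inE zC.
by rewrite /edge zB uB swb.
Qed.

Lemma unlinkedC A B C : C \subset A -> unlinked B C (A :\: C) ->
  unlinked B (A :\: C) (A :\: (A :\: C)).
Proof.
by move=> CA unl x y xC; rewrite setDDr setDv set0U (setIidPr CA) => yC; have [] := unl y x.
Qed.

(** A union of components of the fundamental graph of one basis is a direct
    summand, so its rank is the number of elements of any basis in it. *)
Lemma unlinked_card A B C B' : minimal A B -> C \subset A ->
  unlinked B C (A :\: C) -> minimal A B' -> #|B' :&: C| = #|B :&: C|.
Proof.
move=> mB CA unl mB'; have le1 := unlinked_card_le mB CA unl mB'.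
have := unlinked_card_le mB (subsetDl A C) (unlinkedC CA unl) mB'.
by have := minimal_card mB mB'; rewrite !(card_split _ CA); move: le1; card_lia.
Qed.

(** Move [B1] towards [B2] by exchanges at elements of [A - C]: the counts of
    [unlinked_card] force the incoming elements to lie in [A - C] too, so the
    trace on [C] never changes. *)
Lemma unlinked_combine A B C B1 B2 : minimal A B -> C \subset A ->
  unlinked B C (A :\: C) -> minimal A B1 -> minimal A B2 ->
  exists B3, [/\ minimal A B3, B3 :&: C = B1 :&: C &
    B3 :&: (A :\: C) = B2 :&: (A :\: C)].
Proof.
move=> mB CA unl mB1 mB2.
have [k] := ubnP #|(B1 :&: (A :\: C)) :\: B2|.
elim: k B1 mB1 => // k IHk B1 mB1 ltk.
have cD : #|B1 :&: (A :\: C)| = #|B2 :&: (A :\: C)|.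
  have := minimal_card mB1 mB2; rewrite !(card_split _ CA).
  by rewrite !(unlinked_card mB CA unl) //; card_lia.
have [x|none] := pickP [pred x in (B1 :&: (A :\: C)) :\: B2]; last first.
  exists B1; split=> //; apply/eqP; rewrite eqEcard cD leqnn andbT.
  apply/subsetP => z zB1; rewrite !inE.
  have := none z; have := zB1; rewrite !inE => /andP[-> /andP[-> ->]].
  by rewrite /= !andbT => /negbFE.
rewrite !inE => /andP[xB2 /andP[xB1 /andP[xC xA]]].
have [y [yB2 yB1 swb]] := exch mB1.1 mB2.1 xB1 xB2.
have [yA msw] := minimal_swap mB1 xB1 xA yB1 swb.
have yC : y \notin C.
  have := card_swap C xB1 yB1; rewrite (unlinked_card mB CA unl) //.
  by rewrite (unlinked_card mB CA unl mB1) (negbTE xC); case: (y \in C) => //; card_lia.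
have [|B3 [mB3 eC eD]] := IHk _ msw.
  rewrite -ltnS; apply: leq_trans ltk; rewrite ltnS; apply/proper_card/properP; split.
    apply/subsetP => z; rewrite !inE => /andP[zB2 /andP[/orP[/eqP zy|/andP[_ zB1]] ->]].
      by rewrite zy yB2 in zB2.
    by rewrite zB2 zB1.
  exists x; rewrite !inE ?xB1 ?xB2 ?xC ?xA // eqxx /= orbF !andbT.
  by apply: contraNneq yB1 => <-.
exists B3; split=> //; rewrite eC; apply/setP => z; rewrite !inE.
case zC: (z \in C); rewrite ?andbF // !andbT.
have -> : z == y = false by apply: contraTF zC => /eqP->.
by rewrite (_ : z != x = true) //; apply: contraTneq zC => ->.
Qed.

End Exchange.

(** * Sums of bases and the fundamental graph of a basis *)

Section SumsOfBases.
Variable n : nat.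
Implicit Types (S B C X : {set 'I_n}) (Bs : {set {set 'I_n}}) (u v w : 'X_{1..n}).

Definition mon S : 'X_{1..n} := [multinom (i \in S : nat) | i < n].

(** The exponent vectors of the products of [k] members of the family [Bs]. *)
Definition base_sum Bs k u := exists s : seq {set 'I_n},
  [/\ size s = k, {subset s <= Bs} & u = (\sum_(S <- s) mon S)%MM].

Lemma monU1 S y : y \notin S -> mon (y |: S) = (mon S + U_(y))%MM.
Proof.
move=> yS; apply/mnmP => i; rewrite mnmDE mnm1E !mnmE !inE (eq_sym i y).
by case: eqVneq yS => [->|] /=; [move=> /negbTE -> | rewrite addn0].
Qed.

Lemma base_sum0 Bs : base_sum Bs 0 0%MM.
Proof. by exists [::]; split=> //; rewrite big_nil. Qed.

Lemma base_sumD Bs k l u v : base_sum Bs k u -> base_sum Bs l v ->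
  base_sum Bs (k + l) (u + v)%MM.
Proof.
move=> [s [<- sB ->]] [t [<- tB ->]]; exists (s ++ t); rewrite size_cat big_cat.
by split=> // S; rewrite mem_cat => /orP[/sB|/tB].
Qed.

Lemma base_sum1 Bs B : B \in Bs -> base_sum Bs 1 (mon B).
Proof.
by move=> Bb; exists [:: B]; split=> // [S|]; rewrite ?inE ?big_seq1 // => /eqP->.
Qed.

Lemma base_sum_nseq Bs B k : B \in Bs -> base_sum Bs k (mon B *+ k)%MM.
Proof.
move=> Bb; elim: k => [|k IHk]; first by rewrite mulm0n; apply: base_sum0.
by rewrite mulmSr -addn1; apply: base_sumD IHk (base_sum1 Bb).
Qed.

Lemma base_sum_pad Bs B k t u : B \in Bs -> k <= t -> base_sum Bs k u ->
  base_sum Bs t (u + mon B *+ (t - k))%MM.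
Proof.
by move=> Bb kt uk; rewrite -(subnKC kt) addKn; apply: base_sumD uk (base_sum_nseq _ Bb).
Qed.

(** Connectedness of the fundamental graph induced on [C], stated by cuts. *)
Definition linked Bs B C := forall X, X \proper C -> X != set0 ->
  exists x y, [/\ x \in X, y \in C :\: X & edge Bs B x y || edge Bs B y x].

Lemma mon_swap B x y : x \in B -> y \notin B ->
  (mon (y |: B :\ x) + U_(x) = mon B + U_(y))%MM.
Proof.
move=> xB yB; rewrite monU1 ?inE ?(negbTE yB) ?andbF //.
by rewrite -{2}(setD1K xB) (@monU1 _ x) ?inE ?eqxx // -!addmA [(U_(y) + _)%MM]addmC.
Qed.

(** Grow a connected set [X] from [b0], adding an element [y] of [B] together
    with all its neighbours. If [x] in [X] is the neighbour through which [y] is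
    reached, multiply [w] by the basis [S = B - y + x]. For old [i] this adds a
    factor. For [y] use [S * y = B * x], and for a neighbour [z] of [y] use
    [S * z = (B - y + z) * x]; both reduce to the case of [x] in the old [X].
    The number of factors is the number of elements of [B] in [X]. *)
Lemma linked_socle Bs B C b0 : B \in Bs -> b0 \in B -> b0 \in C -> linked Bs B C ->
  exists w, forall i, i \in C -> base_sum Bs #|B :&: C| (w + U_(i))%MM.
Proof.
move=> Bb b0B b0C conn.
pose nbr b := [set z in C | edge Bs B b z].
have nbrB b : nbr b :&: B = set0.
  apply/setP => z; rewrite !inE; apply/negP => /andP[/andP[_ /and3P[_ /negP nzB _]] zB].
  exact: nzB.
have grow k X w : #|C :\: X| < k -> b0 \in X -> X \subset C ->
    (forall b, b \in X -> b \in B -> nbr b \subset X) ->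
    (forall i, i \in X -> base_sum Bs #|X :&: B| (w + U_(i))%MM) ->
    exists w, forall i, i \in C -> base_sum Bs #|B :&: C| (w + U_(i))%MM.
  elim: k X w => // k IHk X w ltk b0X XC clX sumX.
  have [eqX|neX] := eqVneq X C.
    by exists w; rewrite -eqX setIC.
  have [||x [y [xX]]] := conn X; first by rewrite properEneq neX.
    by apply/set0Pn; exists b0.
  rewrite inE => /andP[yX yC] /orP[exy|/and3P[yB xB swb]].
    have /and3P[xB _ _] := exy; case/negP: yX.
    by apply: (subsetP (clX x xX xB)); rewrite inE yC.
  have sub' : X :|: (y |: nbr y) \subset C.
    rewrite !subUset XC sub1set yC /=; apply/subsetP => z; by rewrite inE => /andP[].
  apply: (IHk (X :|: (y |: nbr y)) (w + mon (x |: B :\ y))%MM) => //.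
  - rewrite -ltnS; apply: leq_trans ltk; rewrite ltnS; apply/proper_card/properP.
    split; first by apply: setDS; apply: subsetUl.
    by exists y; rewrite !inE ?eqxx ?yX ?yC ?orbT.
  - by rewrite inE b0X.
  - move=> b; rewrite !inE => /or3P[bX bB|/eqP-> _|/andP[_ /and3P[_ /negP nbB _]] //].
      by apply: subset_trans (clX b bX bB) (subsetUl _ _).
    by rewrite setUA; apply: subsetUr.
  have -> : #|(X :|: (y |: nbr y)) :&: B| = #|X :&: B| + 1.
    rewrite setIUl setIUl nbrB setU0.
    rewrite (_ : [set y] :&: B = [set y]); last by apply/setIidPl; rewrite sub1set.
    rewrite setUC cardsU1.
    by rewrite !inE (negbTE yX) addnC.
  move=> i; rewrite !inE => /or3P[iX|/eqP->|/andP[_ /and3P[_ iB swi]]].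
  - rewrite -addmA [(mon _ + _)%MM]addmC addmA.
    exact: base_sumD (sumX i iX) (base_sum1 swb).
  - rewrite -addmA mon_swap // [(mon _ + _)%MM]addmC addmA.
    exact: base_sumD (sumX x xX) (base_sum1 Bb).
  rewrite (_ : (_ + _)%MM = (w + U_(x) + mon (i |: B :\ y))%MM).
    exact: base_sumD (sumX x xX) (base_sum1 swi).
  rewrite !monU1 ?inE ?(negbTE iB) ?(negbTE xB) ?andbF //.
  by rewrite [(mon _ + U_(x))%MM]addmC !addmA.
(* Start from w = B - b0, which b0 and its neighbours complete to a basis. *)
pose X0 := b0 |: nbr b0.
have X0C : X0 \subset C.
  by rewrite subUset sub1set b0C; apply/subsetP => z; rewrite inE => /andP[].
apply: (grow _ X0 (mon (B :\ b0)) (leqnn _)) => //.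
- by rewrite !inE eqxx.
- move=> b; rewrite !inE => /orP[/eqP-> _|/andP[_ /and3P[_ /negP nbB _]] //].
  exact: subsetUr.
rewrite setIUl nbrB setU0 (setIidPl _) ?sub1set // cards1.
move=> i; rewrite !inE => /orP[/eqP->|/andP[_ /and3P[_ iB swi]]].
  by rewrite -monU1 ?inE ?eqxx // setD1K //; apply: base_sum1.
by rewrite -monU1 ?inE ?(negbTE iB) ?andbF //; apply: base_sum1.
Qed.

End SumsOfBases.

Section RestrictedSums.
Variable n : nat.
Implicit Types (S A B C X : {set 'I_n}) (Bs : {set {set 'I_n}}) (u v w : 'X_{1..n}).

Definition deg_on A u := \sum_(i in A) u i.

Lemma deg_onD A u v : deg_on A (u + v)%MM = deg_on A u + deg_on A v.
Proof. by rewrite /deg_on -big_split; apply: eq_bigr => i _; rewrite mnmDE. Qed.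

Lemma deg_on_mon A S : deg_on A (mon S) = #|S :&: A|.
Proof.
rewrite /deg_on -sum1_card big_mkcond [RHS]big_mkcond; apply: eq_bigr => i _.
by rewrite mnmE inE andbC; do 2 case: (_ \in _).
Qed.

Lemma deg_on1 A i : i \in A -> deg_on A U_(i)%MM = 1.
Proof.
move=> iA; rewrite /deg_on (bigD1 i) //= mnm1E eqxx big1 // => j /andP[_ ji].
by rewrite mnm1E eq_sym (negbTE ji).
Qed.

Lemma leq_deg_on A u v : (u <= v)%MM -> deg_on A u <= deg_on A v.
Proof. by move=> /mnm_lepP uv; apply: leq_sum => i _. Qed.

Lemma base_sumS Bs k u : base_sum Bs k.+1 u <->
  exists S v, [/\ S \in Bs, base_sum Bs k v & u = (mon S + v)%MM].
Proof.
split=> [[s [szs sB eu]]|[S [v [SB bv ->]]]]; last first.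
  exact: base_sumD (base_sum1 SB) bv.
case: s szs sB eu => [|S s] //= [szs] sB ->; exists S.
exists (\sum_(S <- s) mon S)%MM; split; last by rewrite big_cons.
  by apply: sB; rewrite mem_head.
by exists s; split=> // S' S's; apply: sB; rewrite inE S's orbT.
Qed.

Lemma base_sum_ind Bs (P : nat -> 'X_{1..n} -> Prop) : P 0 0%MM ->
  (forall k S v, S \in Bs -> P k v -> P k.+1 (mon S + v)%MM) ->
  forall k u, base_sum Bs k u -> P k u.
Proof.
move=> P0 PS; elim=> [u [s [/size0nil-> _ ->]]|k IHk u /base_sumS[S [v [SB /IHk Pv ->]]]].
  by rewrite big_nil.
exact: PS.
Qed.

Lemma base_sum_sub Bs Bs' k u : {subset Bs <= Bs'} -> base_sum Bs k u -> base_sum Bs' k u.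
Proof. by move=> sub [s [sz sB ->]]; exists s; split=> // S /sB/sub. Qed.

Lemma deg_on_base_sum_ge Bs A c k u : (forall S, S \in Bs -> c <= #|S :&: A|) ->
  base_sum Bs k u -> k * c <= deg_on A u.
Proof.
move=> Bsc; move: k u; apply: base_sum_ind => // k S v SB le.
by rewrite deg_onD deg_on_mon mulSn leq_add // Bsc.
Qed.

Lemma deg_on_base_sum Bs A c k u : (forall S, S \in Bs -> #|S :&: A| = c) ->
  base_sum Bs k u -> deg_on A u = k * c.
Proof.
move=> Bsc; move: k u; apply: base_sum_ind => [|k S v SB IH].
  by rewrite /deg_on big1 // => i _; rewrite mnm0E.
by rewrite deg_onD deg_on_mon mulSn IH Bsc.
Qed.

Definition minimals Bs A : {set {set 'I_n}} := [set B | `[< minimal Bs A B >]].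

Lemma minimalsP Bs A B : reflect (minimal Bs A B) (B \in minimals Bs A).
Proof. by rewrite inE; apply: asboolP. Qed.

Lemma minimals_sub Bs A : {subset minimals Bs A <= Bs}.
Proof. by move=> B /minimalsP[]. Qed.

Section Exchange.
Variable Bs : {set {set 'I_n}}.
Hypothesis exch : exchange Bs.

Lemma base_sum_minimal A k u : base_sum Bs k u ->
  exists2 v, base_sum (minimals Bs A) k v & forall i, i \in A -> v i <= u i.
Proof.
move: k u; apply: base_sum_ind => [|k S v SB [v' bv' v'v]].
  by exists 0%MM => //; apply: base_sum0.
have [B /minimalsP mB subB] := minimal_below exch A SB.
exists (mon B + v')%MM; first exact: base_sumD (base_sum1 mB) bv'.
move=> i iA; rewrite !mnmDE leq_add ?v'v // !mnmE.
by have := subsetP subB i; rewrite !inE iA !andbT; case: (i \in B) => // ->.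
Qed.

(** Factor by factor, [unlinked_combine] recombines two products of bases
    across a union of components. *)
Lemma base_sum_combine A B C k u v : minimal Bs A B -> C \subset A ->
  unlinked Bs B C (A :\: C) ->
  base_sum (minimals Bs A) k u -> base_sum (minimals Bs A) k v ->
  exists w, [/\ base_sum (minimals Bs A) k w, forall i, i \in C -> w i = u i &
    forall i, i \in A :\: C -> w i = v i].
Proof.
move=> mB CA unl bu; move: k u bu v.
apply: (base_sum_ind (P := fun k u => forall v, _ k v -> exists w, [/\ _ k w, _ & _])).
  move=> v [s [/size0nil-> _ ->]]; exists 0%MM; split=> //; first exact: base_sum0.
  by rewrite big_nil.
move=> k S u /minimalsP mS IH _ /base_sumS[S' [v [/minimalsP mS' bv ->]]].
have [w [bw wu wv]] := IH v bv.
have [S3 [/minimalsP mS3 eC eD]] := unlinked_combine exch mB CA unl mS mS'.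
exists (mon S3 + w)%MM; split; first exact: base_sumD (base_sum1 mS3) bw.
  move=> i iC; rewrite !mnmDE wu // !mnmE.
  by have /setP/(_ i) := eC; rewrite !inE iC !andbT => ->.
move=> i iD; rewrite !mnmDE wv // !mnmE.
by have /setP/(_ i) := eD; rewrite inE [RHS]inE iD !andbT => ->.
Qed.

End Exchange.
End RestrictedSums.

Section DegreesOfSums.
Variable n : nat.
Implicit Types (C : {set 'I_n}) (s : seq 'I_n) (Bs : {set {set 'I_n}}).

Lemma deg_on_sum C (T : Type) (s : seq T) (F : T -> 'X_{1..n}) :
  deg_on C (\sum_(j <- s) F j)%MM = (\sum_(j <- s) deg_on C (F j))%N.
Proof.
elim: s => [|j s IHs]; rewrite ?big_nil ?big_cons ?deg_onD ?IHs //.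
by rewrite /deg_on big1 // => i _; rewrite mnm0E.
Qed.

Lemma deg_on_var C i : deg_on C U_(i)%MM = (i \in C).
Proof.
case: (boolP (i \in C)) => [/deg_on1->//|iC].
by rewrite /deg_on big1 // => j jC; rewrite mnm1E; case: eqP iC => // ->; rewrite jC.
Qed.

Lemma sum_vars_le s s' : uniq s -> {subset s <= s'} ->
  (\sum_(j <- s) U_(j) <= \sum_(j <- s') U_(j))%MM.
Proof.
move=> us ss'; apply/mnm_lepP => i; rewrite !mnm_sumE.
have E t : (\sum_(j <- t) U_(j)%MM i)%N = count_mem i t.
  rewrite -sum1_count [RHS]big_mkcond; apply: eq_bigr => j _.
  by rewrite mnm1E /=; case: eqP.
rewrite !E count_uniq_mem //; case: (boolP (i \in s)) => // /ss'.
by rewrite -has_pred1 has_count.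
Qed.

Lemma base_sum_big Bs (T : eqType) (s : seq T) (k : T -> nat) (F : T -> 'X_{1..n}) :
  (forall a, a \in s -> base_sum Bs (k a) (F a)) ->
  base_sum Bs (\sum_(a <- s) k a)%N (\sum_(a <- s) F a)%MM.
Proof.
elim: s => [|a s IHs] kF; first by rewrite !big_nil; apply: base_sum0.
rewrite !big_cons; apply: base_sumD; first by apply: kF; rewrite mem_head.
by apply: IHs => b bs; apply: kF; rewrite inE bs orbT.
Qed.

End DegreesOfSums.

Section Multinomials.
Variable n : nat.

Lemma mnm_ind (P : 'X_{1..n} -> Prop) : P 0%MM ->
  (forall u i, P u -> P (u + U_(i))%MM) -> forall u, P u.
Proof.
move=> P0 PS u; have [k] := ubnP (mdeg u); elim: k u => // k IHk u ltk.
have [->//|u0] := eqVneq u 0%MM.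
have [i ui] : exists i, (0 < u i)%N.
  apply/existsP; apply: contraNT u0 => /existsPn u0; apply/eqP/mnmP => i.
  by rewrite mnm0E; apply/eqP; rewrite -leqn0 leqNgt.
have le1 : (U_(i) <= u)%MM by rewrite lep1mP -lt0n.
rewrite -(submK le1); apply/PS/IHk.
by move: ltk; rewrite -{1}(submK le1) mdegD mdeg1 addn1.
Qed.

End Multinomials.

Local Open Scope classical_set_scope.
Local Open Scope ring_scope.

(** * Monomial ideals and powers of a matroidal ideal *)

Section MonomialIdeals.
Variables (K : fieldType) (n : nat).
Local Notation R := {mpoly K[n]}.
Implicit Types (U : set 'X_{1..n}) (u v w : 'X_{1..n}) (f g : R).

Definition mon_ideal U : set R := [set g | forall u, u \in msupp g -> U u].

Definition upward U := forall u v, U u -> (u <= v)%MM -> U v.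

Lemma mon_ideal0 U : mon_ideal U 0.
Proof. by move=> u; rewrite msupp0. Qed.

Lemma mon_idealD U f g : mon_ideal U f -> mon_ideal U g -> mon_ideal U (f + g).
Proof. by move=> Uf Ug u /msuppD_le; rewrite mem_cat => /orP[/Uf|/Ug]. Qed.

Lemma mon_idealX U u : mon_ideal U 'X_[u] <-> U u.
Proof.
split=> [|Uu v]; first by apply; rewrite msuppX inE.
by rewrite msuppX inE => /eqP->.
Qed.

Lemma mon_idealZ U c f : mon_ideal U f -> mon_ideal U (c *: f).
Proof. by move=> Uf u /msuppZ_le /Uf. Qed.

Lemma mon_idealM U f g : upward U -> mon_ideal U g -> mon_ideal U (f * g).
Proof.
move=> upU Ug u /msuppM_le /allpairsP[[u1 u2] /= [_ /Ug Uu2 ->]].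
by apply: upU Uu2 _; apply: lem_addl.
Qed.

Lemma mon_idealMX U v g :
  mon_ideal U ('X_[v] * g) <-> forall u, u \in msupp g -> U (v + u)%MM.
Proof.
split=> [Uvg u ug|Uv w /msuppM_le].
  by apply: Uvg; rewrite mcoeff_msupp mulrC mcoeffMX -mcoeff_msupp.
rewrite msuppX => /allpairsP[[u1 u2] /= [+ ug ->]]; rewrite inE => /eqP->.
exact: Uv.
Qed.

Lemma ideal_closed_mon (J : set R) : J 0 -> (forall x y, J x -> J y -> J (x + y)) ->
  (forall a x, J x -> J (a * x)) ->
  forall g, (forall u, u \in msupp g -> J 'X_[u]) -> J g.
Proof.
move=> J0 JD JM g Jg; rewrite (mpolyE g) big_seq.
by apply: (big_ind J) => // u ug; rewrite -mul_mpolyC; apply/JM/Jg.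
Qed.

Lemma Xpow_sum (I : set R) (s : seq 'X_{1..n}) : (forall u, u \in s -> I 'X_[u]) ->
  ideal_pow I (size s) 'X_[(\sum_(u <- s) u)%MM].
Proof.
elim: s => [|u s IHs] Is //=; rewrite big_cons mpolyXD.
apply: sub_ideal_gen; exists 'X_[u]; first by apply: Is; rewrite mem_head.
by eexists; first by apply: IHs => v vs; apply: Is; rewrite inE vs orbT.
Qed.

End MonomialIdeals.

Section Matroidal.
Variables (K : fieldType) (n : nat) (I : set {mpoly K[n]}).
Implicit Types (S B : {set 'I_n}) (u v w : 'X_{1..n}).

Definition bases : {set {set 'I_n}} := [set S | `[< min_gens I (mon S) >]]%SET.

Lemma basesP S : reflect (min_gens I (mon S)) (S \in bases).
Proof. by rewrite inE; apply: asboolP. Qed.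

Definition multiples t : set 'X_{1..n} :=
  [set v | exists2 u, base_sum bases t u & (u <= v)%MM].

Lemma multiples_up t : upward (multiples t).
Proof. by move=> u v [w bw wu] uv; exists w => //; apply: lepm_trans wu uv. Qed.

Hypothesis mI : matroidal I.

Lemma min_gens_mon u : min_gens I u -> exists2 S, u = mon S & S \in bases.
Proof.
move=> Iu; have eu : u = mon [set i | (0 < u i)%N]%SET.
  apply/mnmP => i; rewrite mnmE inE; have := mI.2 u Iu i.
  by case: (u i) => [|[|]].
by exists [set i | (0 < u i)%N]%SET => //; apply/basesP; rewrite -eu.
Qed.

Lemma bases_exchange : exchange bases.
Proof.
move=> B B' /basesP Bb /basesP B'b i iB iB'.
have [_ _ exI] := mI.1; have [|j] := exI _ _ Bb B'b i; first by rewrite !mnmE iB (negbTE iB').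
rewrite !mnmE; case jB: (j \in B); case jB': (j \in B') => // _ Ij.
exists j; split; rewrite ?jB //; apply/basesP.
rewrite (_ : mon _ = (mon B - U_(i) + U_(j))%MM) // monU1 ?inE ?jB ?andbF //.
congr (_ + _)%MM; apply: (@addIm _ U_(i)%MM); rewrite -monU1 ?inE ?eqxx // setD1K //.
by rewrite submK // lep1mP mnmE iB.
Qed.

Lemma ideal_powE t : ideal_pow I t = mon_ideal (multiples t).
Proof.
have [monI _ _] := mI.1; apply/seteqP; split => g.
  elim: t g => [g _ u _|t IHt].
    by exists 0%MM; [apply: base_sum0 | apply/mnm_lepP => i; rewrite mnm0E].
  apply: ideal_gen_min => [|x y|a x|_ [a Ia [b Ib ->]] u].
  - exact: mon_ideal0.
  - exact: mon_idealD.
  - by apply: mon_idealM; apply: multiples_up.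
  move=> /msuppM_le /allpairsP[[u1 u2] /= [u1a u2b ->]].
  have [v bv vu2] := IHt b Ib _ u2b.
  move: Ia; rewrite (min_gens_gen monI) => /mem_monomial_ideal /(_ u1a).
  move=> [_ /min_gens_mon[S -> Sb] Su1].
  exists (mon S + v)%MM; first exact: base_sumD (base_sum1 Sb) bv.
  apply/mnm_lepP => i; rewrite !mnmDE; apply: leq_add; exact/mnm_lepP.
move=> Ug; apply: ideal_closed_mon => [||a x|u /Ug[_ [s [<- sB ->]] su]].
- exact: ideal_pow0.
- exact: ideal_powD.
- exact: ideal_powM.
rewrite -(submK su) mpolyXD; apply: ideal_powM.
have := @Xpow_sum K n I (map (@mon n) s); rewrite size_map big_map; apply.
by move=> _ /mapP[S /sB /basesP[IS _] ->].
Qed.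

End Matroidal.

(** * Associated primes *)

Lemma prime_idealP (A : comNzRingType) (P : set A) : prime_ideal P <->
  [/\ P 0, ~ P 1, forall a x y, P x -> P y -> P (a * x + y) &
      forall x y, P (x * y) -> P x \/ P y].
Proof.
have inP x : (x \in [pred x | x \in P]) = `[< P x >] by rewrite inE.
split=> [[[P0 P1 PD] PM]|[P0 P1 PD PM]].
  split=> [|P1'|a x y Px Py|x y Pxy].
  - by move: P0; rewrite inP => /asboolP.
  - by move: P1; rewrite inP; case/asboolP.
  - by have := PD a x y; rewrite !inP => /(_ (asboolT Px) (asboolT Py)) /asboolP.
  - by have := PM x y; rewrite !inP => /(_ (asboolT Pxy))/orP[]/asboolP; [left|right].
split; first split; rewrite ?inP; first exact: asboolT.
- exact/asboolP.
- by move=> a x y; rewrite !inP => /asboolP Px /asboolP Py; apply/asboolP/PD.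
by move=> x y; rewrite !inP => /asboolP/PM[]?; apply/orP; [left|right]; apply/asboolP.
Qed.

Section MonomialPrimes.
Variables (K : fieldType) (n : nat).
Local Notation R := {mpoly K[n]}.
Implicit Types (A : {set 'I_n}) (U : set 'X_{1..n}) (u v w : 'X_{1..n}) (f g : R).

Definition avoids A v := forall i, i \in A -> v i = 0%N.

(** The ideal generated by the variables in [A]. *)
Definition var_prime A : set R :=
  mon_ideal [set u | exists2 i, i \in A & (0 < u i)%N].

(** The leading monomial of [g] kills that of [f] modulo a monomial ideal
    that contains [g * f]; after one multiplication by it, [f] has one term
    less. *)
Lemma mlead_annihilates U g f k : upward U -> g != 0 -> (size (msupp f) <= k)%N ->
  mon_ideal U (g * f) -> mon_ideal U ('X_[mlead g] ^+ k * f).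
Proof.
move=> upU g0; elim: k f => [|k IHk] f.
  by rewrite leqn0 size_eq0 msupp_eq0 => /eqP->; rewrite !mulr0.
have [->|f0] := eqVneq f 0; first by rewrite !mulr0.
set a := mlead g; set l := mlead f; move=> szf Ugf.
(* The leading terms of g and f cannot cancel in g * f. *)
have Ual : U (a + l)%MM.
  by apply: Ugf; rewrite mcoeff_msupp mleadcM mulf_neq0 // mleadc_eq0.
pose f' := f - f@_l *: 'X_[l].
have Ulead : mon_ideal U ((f@_l *: 'X_[l]) * 'X_[a]).
  by rewrite -scalerAl -mpolyXD addmC; apply: mon_idealZ; apply/mon_idealX.
have -> : 'X_[a] ^+ k.+1 * f =
    'X_[a] ^+ k * (f' * 'X_[a]) + 'X_[a] ^+ k * ((f@_l *: 'X_[l]) * 'X_[a]).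
  by rewrite -mulrDr -mulrDl subrK mulrCA -exprSr mulrC.
apply: mon_idealD; last exact: mon_idealM.
apply: IHk.
  rewrite (perm_size (msuppMX _ _)) size_map (perm_size (msupp_rem _ _)).
  rewrite size_rem ?mlead_supp //.
  by rewrite -ltnS prednK // lt0n size_eq0 msupp_eq0.
rewrite mulrBl mulrBr mulrA -(mulrN g) [_ * 'X_[a]]mulrC.
by apply: mon_idealD; apply: mon_idealM => //; rewrite -scaleN1r; apply: mon_idealZ.
Qed.

(** By [mlead_annihilates] the prime contains the leading monomials, hence all
    monomials, of its elements, and so it is generated by variables. If no
    monomial of [f] had annihilator inside [P], the product of witnesses would
    annihilate [f] without lying in [P]. *)
Lemma Ass_mon_ideal U P : upward U -> Ass (mon_ideal U) P ->
  exists A w, [/\ P = var_prime A, forall i, i \in A -> U (w + U_(i))%MM &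
    forall v, avoids A v -> ~ U (w + v)%MM].
Proof.
move=> upU [primeP [f defP]].
have [P0 P1 PD PM] := (prime_idealP P).1 primeP.
have PE g : P g <-> mon_ideal U (g * f) by rewrite defP.
have P_lead g : P g -> g != 0 -> P 'X_[mlead g].
  move=> /PE Pg g0; have /PE := mlead_annihilates upU g0 (leqnn _) Pg.
  elim: (size _) => [/P1//|k IHk]; rewrite exprS => /PM[|]//.
have P_supp g u : P g -> u \in msupp g -> P 'X_[u].
  have [k] := ubnP (size (msupp g)); elim: k g => // k IHk g ltk Pg ug.
  have g0 : g != 0 by apply: contraTneq ug => ->; rewrite msupp0.
  have [->|neu] := eqVneq u (mlead g); first exact: P_lead.
  have sup := msupp_rem g (mlead g).
  apply: (IHk (g - g@_(mlead g) *: 'X_[mlead g])).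
  - rewrite (perm_size sup) size_rem ?mlead_supp //.
    by rewrite -ltnS prednK // lt0n size_eq0 msupp_eq0.
  - by rewrite addrC -scaleNr -mul_mpolyC; apply: PD => //; apply: P_lead.
  - by rewrite (perm_mem sup) (mem_rem_uniq _ (msupp_uniq _)) inE /= neu.
pose A : {set 'I_n} := [set i | `[< P 'X_i >]]%SET.
have inA i : i \in A <-> P 'X_i by rewrite inE; split => /asboolP.
have P_mon u : P 'X_[u] -> exists2 i, i \in A & (0 < u i)%N.
  elim/mnm_ind: u => [|u i IHu]; first by rewrite mpolyX0.
  rewrite mpolyXD => /PM[/IHu[j jA uj]|Pi]; last first.
    by exists i; [apply/inA | rewrite mnmDE mnm1E eqxx addn1].
  by exists j => //; rewrite mnmDE ltn_addr.
have PA : P = var_prime A.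
  apply/seteqP; split=> g; first by move=> Pg u ug; apply/P_mon/(P_supp g).
  have P_D x y : P x -> P y -> P (x + y).
    by move=> Px Py; rewrite -[x]mul1r; apply: PD.
  have P_M a x : P x -> P (a * x) by move=> Px; rewrite -[_ * _]addr0; apply: PD.
  move=> Ag; apply: ideal_closed_mon => // u /Ag[i /inA Pi ui].
  have le1 : (U_(i) <= u)%MM by rewrite lep1mP -lt0n.
  by rewrite -(submK le1) mpolyXD; apply: P_M.
have [w wf wU] : exists2 w, w \in msupp f & forall v, avoids A v -> ~ U (w + v)%MM.
  apply: contrapT => none.
  have /choice[h hP] : forall u, exists v, u \in msupp f -> avoids A v /\ U (u + v)%MM.
    move=> u; apply: contrapT => nv; apply: none; exists u.
      by apply: contrapT => uf; apply: nv; exists 0%MM.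
    by move=> v Av Uv; apply: nv; exists v.
  pose V := (\sum_(u <- msupp f) h u)%MM.
  have /P_mon[i iA] : P 'X_[V].
    apply/PE/mon_idealMX => u uf; apply: upU (hP u uf).2 _.
    rewrite addmC /V (big_rem u uf) /=; apply/mnm_lepP => i.
    by rewrite !mnmDE leq_add2r leq_addr.
  suff -> : V i = 0%N by [].
  rewrite /V mnm_sumE big_seq big1 // => u uf; exact: (hP u uf).1.
exists A, w; split=> // i /inA /PE /mon_idealMX /(_ w wf).
by rewrite addmC.
Qed.

Lemma var_prime_Ass U A w : upward U -> prime_ideal (var_prime A) ->
  (forall i, i \in A -> U (w + U_(i))%MM) ->
  (forall v, avoids A v -> ~ U (w + v)%MM) -> Ass (mon_ideal U) (var_prime A).
Proof.
move=> upU pA Aw nAw; split=> //; exists 'X_[w]; apply/seteqP; split=> g /= Ag.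
  rewrite mulrC; apply/mon_idealMX => u /Ag[i iA ui]; apply: upU (Aw i iA) _.
  by apply/mnm_lepP => j; rewrite !mnmDE leq_add2l mnm1E; case: eqP => // <-.
move: Ag; rewrite mulrC => /mon_idealMX Ag u /Ag Uu.
apply: contrapT => nu; apply: nAw Uu => i iA.
by apply/eqP; rewrite -leqn0 leqNgt; apply/negP => ui; apply: nu; exists i.
Qed.

End MonomialPrimes.

Section AssPowers.
Variables (K : fieldType) (n d : nat) (I : set {mpoly K[n]}).
Implicit Types (S A B : {set 'I_n}) (u v w : 'X_{1..n}).
Hypotheses (mI : matroidal I) (dI : gens_degree I d).
Local Notation Bs := (bases I).

Lemma card_base B : B \in Bs -> #|B| = d.
Proof.
move=> /basesP /dI <-; rewrite mdegE -sum1_card big_mkcond; apply: eq_bigr => i _.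
by rewrite mnmE; case: (_ \in _).
Qed.

(** Connectedness of the contraction to [A], read off one of its bases; the
    requirement that [B] meets [A] excludes a single loop. *)
Definition connected_contraction A := exists B,
  [/\ minimal Bs A B, exists2 b, b \in B & b \in A & linked Bs B A].

(** If the contraction splits along [X], then multiplying [w] by a variable
    outside [X] does not help inside [X], and conversely. So [w] is already
    divisible by a product of [t] bases on [X] and by another one on [A - X],
    and these recombine. *)
Lemma connected_contraction_of_socle t A w B0 : B0 \in Bs ->
  (forall i, i \in A -> multiples I t (w + U_(i))%MM) ->
  (forall v, avoids A v -> ~ multiples I t (w + v)%MM) ->
  connected_contraction A.
Proof.
have exch := bases_exchange mI; move=> B0b Aw nAw.
have [B mB _] := minimal_below exch A B0b; exists B; split=> //.
  apply: contrapT => nob; apply: (nAw (mon B *+ t)%MM).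
    move=> i iA; rewrite mulmnE mnmE; case iB: (i \in B); rewrite ?mul0n //.
    by case: nob; exists i.
  by exists (mon B *+ t)%MM; [apply: base_sum_nseq mB.1 | apply: lem_addl].
move=> X ltX X0; apply: contrapT => noedge.
have XA := proper_sub ltX.
have unl : unlinked Bs B X (A :\: X).
  move=> x y xX yX; split; apply/negP => e; apply: noedge; exists x, y; split=> //.
    by rewrite e.
  by rewrite e orbT.
have below i : i \in A -> exists2 u, base_sum (minimals Bs A) t u &
    forall j, j \in A -> (u j <= w j + (i == j))%N.
  move=> /Aw[u0 bu0 le0]; have [u bu leu] := base_sum_minimal exch A bu0.
  exists u => // j jA; apply: leq_trans (leu j jA) _.
  by have /mnm_lepP/(_ j) := le0; rewrite mnmDE mnm1E.
have /properP[_ [i iA iX]] := ltX.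
have [k kX] := set0Pn _ X0.
have [u1 b1 le1] := below i iA; have [u2 b2 le2] := below k (subsetP XA _ kX).
have [u [bu eX eD]] := base_sum_combine exch mB XA unl b1 b2.
(* Outside A any exponent may be supplied, as w only matters on A. *)
pose v := [multinom if j \in A then 0%N else u j | j < n].
apply: (nAw v) => [j jA|]; first by rewrite mnmE jA.
exists u; first exact: base_sum_sub (@minimals_sub _ _ _) bu.
apply/mnm_lepP => j; rewrite mnmDE mnmE; case: ifP => [jA|_]; last exact: leq_addl.
rewrite addn0; case jX: (j \in X).
  rewrite eX //; have := le1 j jA; case: eqP => [ij|_]; last by rewrite addn0.
  by rewrite ij jX in iX.
rewrite eD ?inE ?jX ?jA //; have := le2 j jA; case: eqP => [kj|_]; last by rewrite addn0.
by rewrite -kj kX in jX.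
Qed.

(** The monomial of [linked_socle], padded by copies of [B]. Its degree in
    the variables of [A] is one less than [t] times the rank of the
    contraction, which keeps its multiples by the other variables out of the
    power. *)
Lemma socle_of_connected_contraction t A : (d <= t)%N -> connected_contraction A ->
  exists w, (forall i, i \in A -> multiples I t (w + U_(i))%MM) /\
            (forall v, avoids A v -> ~ multiples I t (w + v)%MM).
Proof.
move=> dt [B [mB [b bB bA] lB]].
have Bm : B \in minimals Bs A by apply/minimalsP.
have lB' : linked (minimals Bs A) B A.
  move=> X ltX X0; have [x [y [xX yX e]]] := lB X ltX X0.
  have xA := subsetP (proper_sub ltX) x xX.
  have yA : y \in A by move: yX; rewrite inE => /andP[].
  exists x, y; split=> //; case/orP: e => /and3P[zB z'B swb]; apply/orP; [left|right].
    by apply/and3P; split=> //; apply/minimalsP; case: (minimal_swap mB zB xA z'B swb).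
  by apply/and3P; split=> //; apply/minimalsP; case: (minimal_swap mB zB yA z'B swb).
have [w0 w0P] := linked_socle Bm bB bA lB'.
have kt : (#|B :&: A| <= t)%N.
  by apply: leq_trans dt; rewrite -(card_base mB.1); apply/subset_leq_card/subsetIl.
pose w := (w0 + mon B *+ (t - #|B :&: A|))%MM.
have wP i : i \in A -> base_sum (minimals Bs A) t (w + U_(i))%MM.
  move=> iA; have := base_sum_pad Bm kt (w0P i iA).
  by rewrite -!addmA [(U_(_) + _)%MM]addmC !addmA.
exists w; split=> [i /wP bi|v Av [u bu /leq_deg_on - /(_ A)]].
  by exists (w + U_(i))%MM; [apply: base_sum_sub bi; apply: minimals_sub | apply: lepm_refl].
have := deg_on_base_sum_ge mB.2 bu; rewrite deg_onD.
have -> : deg_on A v = 0%N by rewrite /deg_on big1 // => i /Av.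
have := @deg_on_base_sum _ _ A #|B :&: A| _ _ _ (wP b bA).
rewrite deg_onD deg_on1 // => <-; last first.
  by move=> S /minimalsP mS; apply: minimal_card mS mB.
by rewrite addn0 => le1 le2; have := leq_trans le1 le2; rewrite addn1 ltnn.
Qed.

Lemma Ass_pow_sub s t B0 : B0 \in Bs -> (d <= t)%N ->
  Ass (ideal_pow I s) `<=` Ass (ideal_pow I t).
Proof.
move=> B0b dt P aP; have primeP := aP.1; move: aP; rewrite !ideal_powE //.
move=> /(Ass_mon_ideal (@multiples_up _ _ _ _))[A [w [eP Aw nAw]]].
have [w' [Aw' nAw']] :=
  socle_of_connected_contraction dt (connected_contraction_of_socle B0b Aw nAw).
by rewrite eP in primeP *; apply: var_prime_Ass Aw' nAw' => //; apply: multiples_up.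
Qed.

End AssPowers.

(** * Regular sequences and the Koszul-type complex of list cochains *)

Section ListCochains.
Variables (T : Type) (A : comNzRingType).
Implicit Types (x y : T -> A) (phi psi : seq T -> A) (s : seq T).

(** Cochains of degree [k] are arbitrary functions on the lists of length [k],
    not only alternating ones, so this is not the Koszul complex but the dual of
    its tensor analogue: the value at [j1 ... jk] is the alternating sum of
    [x_ji] times the value at the list without [ji]. The recursion on the list
    hides the signs, and the homotopies needed below exist all the same. *)
Fixpoint cobd x phi s : A :=
  if s is j :: s' then x j * phi s' - cobd x (fun s => phi (j :: s)) s' else 0.

Lemma eq_cobd x phi psi : phi =1 psi -> cobd x phi =1 cobd x psi.
Proof.
move=> e s; elim: s phi psi e => //= j s IHs phi psi e.
by rewrite e (IHs _ (fun s => psi (j :: s))).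
Qed.

Lemma cobdB x c phi psi s :
  cobd x (fun s => c * phi s - psi s) s = c * cobd x phi s - cobd x psi s.
Proof.
elim: s phi psi => [|j s IHs] phi psi /=; first by rewrite mulr0 subr0.
by rewrite IHs; ring.
Qed.

Lemma cobdZ x c phi s : cobd x (fun s => c * phi s) s = c * cobd x phi s.
Proof.
elim: s phi => [|j s IHs] phi /=; first by rewrite mulr0.
by rewrite IHs; ring.
Qed.

Lemma cobd_vanish x phi (Q : pred T) : (forall s, all Q s -> phi s = 0) ->
  forall s, all Q s -> cobd x phi s = 0.
Proof.
move=> phi0 s; elim: s phi phi0 => //= j s IHs phi phi0 /andP[Qj Qs].
rewrite phi0 // mulr0 sub0r IHs ?oppr0 // => s' Qs'.
by apply: phi0; rewrite /= Qj.
Qed.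

Lemma cobd_cobd x phi s : cobd x (cobd x phi) s = 0.
Proof.
elim: s phi => //= j s IHs phi.
by rewrite cobdB IHs subr0 subrr.
Qed.

Lemma cobd_anticomm x y phi s : cobd x (cobd y phi) s = - cobd y (cobd x phi) s.
Proof.
elim: s phi => [|j s IHs] phi /=; first by rewrite oppr0.
by rewrite !cobdB (IHs (fun s => phi (j :: s))); ring.
Qed.

Lemma cobd_sum (J : finType) x (a : J -> A) (phi : J -> seq T -> A) s :
  cobd x (fun s => \sum_j a j * phi j s) s = \sum_j a j * cobd x (phi j) s.
Proof.
elim: s phi => [|j s IHs] phi /=; first by rewrite big1 // => i _; rewrite mulr0.
rewrite (IHs (fun i s => phi i (j :: s))) mulr_sumr -sumrB.
by apply: eq_bigr => i _; ring.
Qed.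

Lemma cobd_ideal (J : set A) x phi i : (forall b c, J b -> J c -> J (b + c)) ->
  (forall b c, J c -> J (b * c)) -> (forall s, size s = i -> J (phi s)) ->
  forall s, size s = i.+1 -> J (cobd x phi s).
Proof.
move=> JD JM; elim: i phi => [|i IHi] phi Jphi [|j s] //= [szs].
  by rewrite (size0nil szs) /= subr0; apply: JM; apply: Jphi.
apply: JD; first by apply: JM; apply: Jphi.
by rewrite -mulN1r; apply: JM; apply: IHi => // s' szs'; apply: Jphi; rewrite /= szs'.
Qed.

Lemma eq_cobd_vars x y phi s : x =1 y -> cobd x phi s = cobd y phi s.
Proof. by move=> xy; elim: s phi => //= j s IHs phi; rewrite xy IHs. Qed.

Lemma cobd_sum_vars (L : eqType) (l : seq L) (y : L -> T -> A) phi s :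
  cobd (fun j => \sum_(a <- l) y a j) phi s = \sum_(a <- l) cobd (y a) phi s.
Proof.
elim: s phi => [|j s IHs] phi /=; first by rewrite big1.
by rewrite IHs mulr_suml -sumrB.
Qed.

Lemma cobd_vars0 x phi (Q : pred T) s : (forall j, Q j -> x j = 0) ->
  all Q s -> cobd x phi s = 0.
Proof.
move=> x0; elim: s phi => //= j s IHs phi /andP[Qj Qs].
by rewrite x0 // mul0r sub0r IHs ?oppr0.
Qed.

End ListCochains.

Section Vanishing.
Variables (T : finType) (A : comNzRingType) (x : T -> A).

Lemma ideal_genU1 (J : set A) f y : J 0 -> (forall y z, J y -> J z -> J (y + z)) ->
  (forall b y, J y -> J (b * y)) ->
  ideal_gen (J `|` [set f]) y -> exists v, J (y - f * v).
Proof.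
move=> J0 JD JM.
apply: (@ideal_gen_min _ _ [set y | exists v, J (y - f * v)]) =>
  [|y1 y2 [v1 J1] [v2 J2]|b z [v Jz]|z].
- by exists 0; rewrite mulr0 subr0.
- by exists (v1 + v2); rewrite mulrDr opprD addrACA; apply: JD.
- by exists (b * v); rewrite mulrCA -mulrBr; apply: JM.
by case=> [Jz|->]; [exists 0; rewrite mulr0 subr0 | exists 1; rewrite mulr1 subrr].
Qed.

(** Multiplication by [f = sum a_j x_j] is homotopic to zero through
    [h phi s = sum a_j phi (j :: s)]. So for a cocycle [phi] modulo [J],
    [f phi] is the coboundary of [h phi], and [h phi] is a cocycle of lower
    degree modulo [J + (f)]. By induction it is a coboundary modulo [J + (f)];
    then [f phi] is [f] times a coboundary modulo [J], and [f] cancels. *)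
Lemma cocycle_is_coboundary (J : set A) fs i (phi : seq T -> A) :
  J 0 -> (forall y z, J y -> J z -> J (y + z)) -> (forall b y, J y -> J (b * y)) ->
  (forall f, f \in fs -> exists a : T -> A, f = \sum_j a j * x j) ->
  regular_seq J fs -> (i < size fs)%N ->
  (forall s, size s = i.+1 -> J (cobd x phi s)) ->
  exists psi, forall s, size s = i -> J (phi s - cobd x psi s).
Proof.
elim: fs J i phi => // f fs IHfs J i phi J0 JD JM fsx [regf regfs] lti dphi.
have [a fa] := fsx f (mem_head _ _).
pose h s := \sum_j a j * phi (j :: s).
have homotopy s : \sum_j a j * cobd x phi (j :: s) = f * phi s - cobd x h s.
  rewrite /h (cobd_sum _ _ (fun j s => phi (j :: s))) fa mulr_suml -sumrB.
  by apply: eq_bigr => j _ /=; ring.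
have Jsum s : size s = i -> J (f * phi s - cobd x h s).
  move=> szs; rewrite -homotopy; apply: (big_ind J) => // j _.
  by apply: JM; apply: dphi; rewrite /= szs.
have JB y z : J y -> J z -> J (y - z) by move=> Jy Jz; rewrite -mulN1r; apply: JD => //; apply: JM.
case: i lti dphi Jsum => [|i] lti dphi Jsum.
  exists (fun=> 0) => s szs; rewrite (size0nil szs) /= subr0; apply: regf.
  by have := Jsum [::] erefl; rewrite /= subr0.
have [|||||||psi psiP] := IHfs (ideal_gen (J `|` [set f])) i h.
- exact: ideal_gen0.
- exact: ideal_genD.
- exact: ideal_genM.
- by move=> g gfs; apply: fsx; rewrite inE gfs orbT.
- by [].
- by [].
- move=> s szs; rewrite (_ : cobd x h s = phi s * f - (f * phi s - cobd x h s)).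
    apply: ideal_genD; first by apply: ideal_genM; apply: sub_ideal_gen; right.
    by rewrite -mulN1r; apply: ideal_genM; apply: sub_ideal_gen; left; apply: Jsum.
  by ring.
have /choice[v vP] : forall s, exists v, size s = i -> J (h s - cobd x psi s - f * v).
  move=> s; have [/psiP/(ideal_genU1 J0 JD JM)[v Jv]|ns] := eqVneq (size s) i.
    by exists v.
  by exists 0 => szs; rewrite szs eqxx in ns.
exists v => s szs; apply: regf.
have := @cobd_ideal _ _ J x _ i JD JM vP s szs.
rewrite (@eq_cobd _ _ _ _
  (fun s => 1 * (1 * h s - cobd x psi s) - f * v s)); last first.
  by move=> s'; rewrite !mul1r.
rewrite (cobdB _ 1 (fun s => 1 * h s - cobd x psi s)) cobdB cobdZ cobd_cobd subr0.
rewrite !mul1r mulrBr => Jhv.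
by rewrite -(subrK (cobd x h s) (f * phi s)) -addrA; apply: JD Jhv; apply: Jsum.
Qed.

End Vanishing.

Section ComponentClass.
Variables (A : comNzRingType) (T : eqType) (r : T -> T).
Implicit Types (l s : seq T).

Definition in_part a j : A := (r j == a)%:R.

(** The coefficients of the class that obstructs long regular sequences: the
    coboundaries [d_a] that only use the variables of the part [a], applied one
    after the other to the cochain that is 1 at the empty list. *)
Definition part_class l : seq T -> A :=
  foldr (fun a phi => cobd (in_part a) phi) (fun s => (nilp s)%:R) l.

Lemma part_class_miss a l s : a \in l -> all (fun j => r j != a) s -> part_class l s = 0.
Proof.
elim: l s => //= b l IHl s; rewrite inE => /orP[/eqP<-|al].
  by apply: cobd_vars0 => j /negbTE ra; rewrite /in_part ra.
by apply: cobd_vanish => s' /IHl; apply.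
Qed.

Lemma cobd_part_class a l s : a \in l -> cobd (in_part a) (part_class l) s = 0.
Proof.
elim: l s => //= b l IHl s; rewrite inE => /orP[/eqP->|al]; first exact: cobd_cobd.
rewrite cobd_anticomm (@cobd_vanish _ _ _ _ predT) ?oppr0 ?all_predT //.
by move=> s' _; apply: IHl.
Qed.

(** The full coboundary is the sum of the [d_a], which anticommute and have
    square zero: only the part that is missing from [l] contributes. *)
Lemma cobd1_part_class a l s : uniq (a :: l) -> (forall j, r j \in a :: l) ->
  cobd (fun=> 1) (part_class l) s = part_class (a :: l) s.
Proof.
move=> ul rl; rewrite (@eq_cobd_vars _ _ _ (fun j => \sum_(b <- a :: l) in_part b j)).
  rewrite cobd_sum_vars big_cons big_seq big1 ?addr0 // => b bl.
  exact: cobd_part_class.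
move=> j; rewrite (bigD1_seq (r j)) //= /in_part eqxx big1 ?addr0 // => b.
by rewrite eq_sym => /negbTE->.
Qed.

Lemma part_class_diag l : uniq l -> {in l, forall a, r a = a} -> part_class l l = 1.
Proof.
elim: l => //= a l IHl /andP[al ul] ra.
rewrite {1}/in_part ra ?mem_head // eqxx mul1r IHl //; last first.
  by move=> b bl; apply: ra; rewrite inE bl orbT.
rewrite (@cobd_vars0 _ _ _ _ (fun j => r j != a)) ?subr0 //.
  by move=> j /negbTE rj; rewrite /in_part rj.
apply/allP => b bl; rewrite ra ?inE ?bl ?orbT //.
by apply: contraNneq al => <-.
Qed.

End ComponentClass.

Section DepthUpperBound.
Variables (K : fieldType) (n : nat).
Local Notation R := {mpoly K[n]}.
Implicit Types (U : set 'X_{1..n}) (u v w : 'X_{1..n}) (s l : seq 'I_n).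

(** Evaluating a cochain at [s] in degree [mshift w s] makes the variables
    act as 1 on coefficients: see [mcoeff_cobd] and [cobd_scaleX]. *)
Definition mshift w s : 'X_{1..n} := (w + \sum_(j <- s) U_(j))%MM.

Lemma mshift_cons w j s : mshift w (j :: s) = mshift (w + U_(j))%MM s.
Proof. by rewrite /mshift big_cons addmA. Qed.

Local Notation X := (fun j : 'I_n => 'X_j : R).

Lemma mcoeff_cobd w (psi : seq 'I_n -> R) s :
  (cobd X psi s)@_(mshift w s) = cobd (fun=> 1) (fun s => (psi s)@_(mshift w s)) s.
Proof.
elim: s w psi => [|j s IHs] w psi /=; first by rewrite mcoeff0.
rewrite mcoeffB mul1r; congr (_ - _).
  rewrite mulrC /mshift big_cons addmA [(w + _)%MM]addmC -addmA mcoeffMX.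
  by [].
rewrite mshift_cons IHs; apply: eq_cobd => s'; by rewrite mshift_cons.
Qed.

Lemma cobd_scaleX w (c : seq 'I_n -> K) s :
  cobd X (fun s => c s *: 'X_[mshift w s]) s = cobd (fun=> 1) c s *: 'X_[mshift w s].
Proof.
elim: s w c => [|j s IHs] w c /=; first by rewrite scale0r.
rewrite mul1r scalerBl; congr (_ - _).
  by rewrite -scalerAr -mpolyXD /mshift big_cons addmA [(U_(j) + _)%MM]addmC addmA.
rewrite mshift_cons -IHs; apply: eq_cobd => s'; by rewrite mshift_cons.
Qed.

Lemma irrelevant_comb (f : R) : irrelevant f ->
  exists a : 'I_n -> R, f = \sum_j a j * X j.
Proof.
move: f; apply: ideal_gen_min => [|f g [a ->] [b ->]|c f [a ->]|_ [i _ <-]].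
- by exists (fun=> 0); rewrite big1 // => j _; rewrite mul0r.
- by exists (fun j => a j + b j); rewrite -big_split; apply: eq_bigr => j _; rewrite mulrDl.
- by exists (fun j => c * a j); rewrite mulr_sumr; apply: eq_bigr => j _; rewrite mulrA.
exists (fun j => (j == i)%:R); rewrite (bigD1 i) //= eqxx mul1r big1 ?addr0 //.
by move=> j /negbTE->; rewrite mul0r.
Qed.

(** Here [r] sends a variable to the representative of its part. The cochain
    with coefficients [part_class r l] is a cocycle modulo [U], because its
    coboundary only lives on lists that meet all parts. If it were a coboundary
    modulo [U] in degree [size l], it would be one exactly, since lists that
    short miss a part and give monomials outside [U]; but its coboundary takes
    the value 1 at [a0 :: l]. *)
Lemma regular_seq_bound U (r : 'I_n -> 'I_n) a0 l w fs : upward U ->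
  uniq (a0 :: l) -> {in a0 :: l, forall a, r a = a} -> (forall j, r j \in a0 :: l) ->
  (forall s, U (mshift w s) <-> forall a, a \in a0 :: l -> has (fun j => r j == a) s) ->
  (forall f : R, f \in fs -> irrelevant f) -> regular_seq (mon_ideal U) fs ->
  (size fs <= size l)%N.
Proof.
move=> upU ul rl rin Uw fsm regfs; rewrite leqNgt; apply/negP => lt.
pose c := part_class K r l.
have d_c s : cobd (fun=> 1) c s = part_class K r (a0 :: l) s.
  exact: cobd1_part_class.
have J_d s : mon_ideal U (cobd X (fun s => c s *: 'X_[mshift w s]) s).
  rewrite cobd_scaleX d_c.
  have [a /andP[al hasa]|none] := pickP (fun a => (a \in a0 :: l) && all (fun j => r j != a) s).
    by rewrite (part_class_miss _ al hasa) scale0r; apply: mon_ideal0.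
  apply: mon_idealZ; apply/mon_idealX/Uw => a al.
  by have := none a; rewrite al /= => /negbT /allPn[j js /negPn rj]; apply/hasP; exists j.
have [psi psiP] : exists psi, forall s, size s = size l ->
    mon_ideal U (c s *: 'X_[mshift w s] - cobd X psi s).
  apply: (cocycle_is_coboundary _ _ _ _ regfs lt) => //.
  - exact: mon_ideal0.
  - exact: mon_idealD.
  - by move=> b y; apply: mon_idealM.
  - by move=> f /fsm /irrelevant_comb.
pose psi' s := (psi s)@_(mshift w s).
have c_d s : size s = size l -> c s = cobd (fun=> 1) psi' s.
  move=> szs; apply/eqP; rewrite -subr_eq0 -mcoeff_cobd.
  have := psiP s szs (mshift w s); rewrite mcoeff_msupp mcoeffB mcoeffZ mcoeffX eqxx mulr1.
  case: eqP => // _ /(_ isT) /Uw hs.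
  (* A list of length [size l] cannot meet all parts. *)
  have /uniq_leq_size : {subset a0 :: l <= map r s}.
    by move=> a /hs/hasP[j js /eqP<-]; apply: map_f.
  by move=> /(_ ul); rewrite size_map szs /= ltnn.
have : cobd (fun=> 1) (fun s => 1 * c s - cobd (fun=> 1) psi' s) (a0 :: l) = 0.
  apply: (@cobd_ideal _ _ [set 0 : K] _ _ (size l)) => // [x y -> ->|x y ->|s szs] /=.
  - by rewrite addr0.
  - by rewrite mulr0.
  by rewrite mul1r -c_d // subrr.
by rewrite cobdB mul1r cobd_cobd subr0 d_c part_class_diag // => /eqP; rewrite oner_eq0.
Qed.

End DepthUpperBound.

(** * Identifying variables *)

Section Identification.
Variables (K : fieldType) (n : nat).
Local Notation R := {mpoly K[n]}.
Implicit Types (U V : set 'X_{1..n}) (u v w : 'X_{1..n}) (f g : R) (s : 'I_n -> 'I_n).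

(** The exponent vector of the image of a monomial under the substitution of
    [x_(s i)] for [x_i]. *)
Definition mapm s u : 'X_{1..n} := (\sum_i U_(s i) *+ u i)%MM.

Definition subst s : R -> R := mmap (@mpolyC n K) (fun i => 'X_(s i)).

HB.instance Definition _ s := GRing.RMorphism.on (subst s).

Lemma substX s u : subst s 'X_[u] = 'X_[mapm s u].
Proof. by rewrite /subst mmapX /mmap1 mprodXnE. Qed.

Lemma substZ s c g : subst s (c *: g) = c *: subst s g.
Proof. by rewrite -!mul_mpolyC rmorphM /= {1}/subst mmapC. Qed.

Lemma mapmE s u i : mapm s u i = (\sum_(j | s j == i) u j)%N.
Proof.
rewrite /mapm mnm_sumE [RHS]big_mkcond; apply: eq_bigr => j _.
by rewrite mulmnE mnm1E; case: (s j == i); rewrite ?mul1n.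
Qed.

Lemma mapm_le s u v : (u <= v)%MM -> (mapm s u <= mapm s v)%MM.
Proof.
by move=> /mnm_lepP uv; apply/mnm_lepP => i; rewrite !mapmE leq_sum.
Qed.

Lemma mapm1 s i : mapm s U_(i)%MM = U_(s i)%MM.
Proof.
apply/mnmP => j; rewrite mapmE mnm1E (bigID (pred1 i)) /=.
rewrite [X in (_ + X)%N]big1 ?addn0; last first.
  by move=> k /andP[_ ki]; rewrite mnm1E eq_sym (negbTE ki).
case: eqP => [si|/eqP si]; last first.
  by rewrite big1 // => k /andP[/eqP sk /eqP ki]; rewrite -sk ki eqxx in si.
rewrite (big_pred1 i) ?mnm1E ?eqxx // => k /=.
by case: (eqVneq k i) => [->|_]; rewrite ?si ?eqxx ?andbF.
Qed.

Lemma substXU s i : subst s 'X_i = 'X_(s i).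
Proof. by rewrite substX mapm1. Qed.

Lemma mapm_comp s s' u : mapm s (mapm s' u) = mapm (s \o s') u.
Proof.
have mapm0 t : mapm t 0%MM = 0%MM.
  by apply/mnmP => i; rewrite mapmE mnm0E big1 // => j _; rewrite mnm0E.
have mapmD t v w : mapm t (v + w)%MM = (mapm t v + mapm t w)%MM.
  by apply/mnmP => i; rewrite mnmDE !mapmE -big_split; apply: eq_bigr => j _; rewrite mnmDE.
elim/mnm_ind: u => [|u i IHu]; first by rewrite !mapm0.
by rewrite !mapmD IHu !mapm1.
Qed.

Lemma substE s g : subst s g = \sum_(u <- msupp g) g@_u *: 'X_[mapm s u].
Proof.
rewrite /subst /mmap; apply: eq_bigr => u _.
by rewrite mul_mpolyC /mmap1 mprodXnE.
Qed.

Lemma subst_sum s (T : Type) (r : seq T) (F : T -> R) :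
  subst s (\sum_(i <- r) F i) = \sum_(i <- r) subst s (F i).
Proof. exact: (rmorph_sum (subst s)). Qed.

Lemma subst_comp s s' g : subst s (subst s' g) = subst (s \o s') g.
Proof.
rewrite [subst s' g]substE subst_sum [RHS]substE; apply: eq_bigr => u _.
by rewrite substZ substX mapm_comp.
Qed.

Lemma subst_id g : subst id g = g.
Proof.
rewrite substE [RHS]mpolyE; apply: eq_bigr => u _; congr (_ *: 'X_[_]).
by apply/mnmP => i; rewrite mapmE (big_pred1 i).
Qed.

(** Take a monomial of [g] outside [V] with the largest exponent of [z]. Its
    product with [x_z] cannot be cancelled by a term of [x_y * g], so it lies
    in [V], which ignores [z]. *)
Lemma diff_regular V y z g : upward V -> y != z -> (forall u, V (u + U_(z))%MM -> V u) ->
  mon_ideal V (('X_y - 'X_z) * g) -> mon_ideal V g.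
Proof.
move=> upV yz Vz Vg u ug; apply: contrapT => nVu.
have [k] := ubnP (msize g - u z); elim: k u ug nVu => // k IHk u ug nVu ltk.
have nV' : ~ V (u + U_(z))%MM by move/Vz.
have : (('X_y - 'X_z) * g)@_(u + U_(z)) == 0.
  by apply/negPn/negP; rewrite -mcoeff_msupp => /Vg.
rewrite mulrBl mcoeffB [(u + _)%MM]addmC ['X_z * g]mulrC mcoeffMX subr_eq0 => /eqP eyz.
have : (U_(z) + u)%MM \in msupp (g * 'X_y).
  by rewrite mcoeff_msupp mulrC eyz -mcoeff_msupp.
rewrite (perm_mem (msuppMX _ _)) => /mapP[u' u'g euu'].
have u'z : u' z = (u z).+1.
  have /mnmP/(_ z) := euu'; rewrite !mnmDE !mnm1E eqxx (negbTE yz) add1n add0n.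
  by move=> ->.
apply: (IHk u') => //.
  by move=> Vu'; apply: nV'; rewrite addmC euu'; apply: upV Vu' _; apply: lem_addl.
have lt_uz : (u z < msize g)%N.
  apply: leq_ltn_trans (msize_mdeg_lt ug); rewrite mdegE (bigD1 z) //=.
  exact: leq_addr.
by move: ltk; rewrite u'z subnS; move: lt_uz; clear; lia.
Qed.

Definition image_up s U : set 'X_{1..n} :=
  [set v | exists2 u, U u & (mapm s u <= v)%MM].

Lemma image_up_up s U : upward (image_up s U).
Proof. by move=> v w [u Uu uv] vw; exists u => //; apply: lepm_trans uv vw. Qed.

(** The preimage of the image of the monomial ideal of [U] under the
    substitution [s]. For the idempotent [s] used here this is the ideal
    generated by [U] and all [x_i - x_(s i)], but membership only
    involves monomials. *)
Definition stage U s : set R := [set g | mon_ideal (image_up s U) (subst s g)].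

Lemma stage0 U s : stage U s 0.
Proof. by rewrite /stage /= rmorph0; apply: mon_ideal0. Qed.

Lemma stageD U s f g : stage U s f -> stage U s g -> stage U s (f + g).
Proof. by rewrite /stage /= rmorphD; apply: mon_idealD. Qed.

Lemma stageM U s f g : stage U s g -> stage U s (f * g).
Proof. by rewrite /stage /= rmorphM; apply: mon_idealM; apply: image_up_up. Qed.

Definition glue a0 a i : 'I_n := if i == a then a0 else i.

(** Every polynomial is congruent to its image under the substitution modulo
    the differences of variables, so a generator of the image ideal may be
    replaced by the monomial of [U] that it comes from. *)
Lemma stage_glue U s a0 a : upward U -> (forall i, s (s i) = s i) -> s a0 = a0 -> s a = a ->
  ideal_gen (stage U s `|` [set 'X_a0 - 'X_a]) = stage U (glue a0 a \o s).
Proof.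
move=> upU ss sa0 sa; set s' := _ \o s; set J := ideal_gen _.
have glue_a0 : glue a0 a a0 = a0 by rewrite /glue; case: eqP.
apply/seteqP; split=> g.
  move: g; apply: ideal_gen_min => [|f g|f g|g [Qg|->]].
  - exact: stage0.
  - exact: stageD.
  - exact: stageM.
  - rewrite /stage /= -subst_comp; move: Qg; rewrite /stage /=.
    move: (subst s g) => h Uh; rewrite (substE _ h) big_seq.
    apply: (big_ind (mon_ideal _)) => [||v /Uh[u Uu uv]].
    + exact: mon_ideal0.
    + exact: mon_idealD.
    apply: mon_idealZ; apply/mon_idealX.
    by exists u => //; rewrite -mapm_comp; apply: mapm_le.
  rewrite /stage /= rmorphB /= !substXU /s' /= sa sa0 glue_a0 /glue eqxx subrr.
  exact: mon_ideal0.
have stJ f : stage U s f -> J f by move=> Qf; apply: sub_ideal_gen; left.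
have JB f h : J f -> J h -> J (f - h).
  by move=> Jf Jh; rewrite -mulN1r; apply: ideal_genD => //; apply: ideal_genM.
(* Since s is idempotent, [x_i - x_(s i)] already lies in the stage of s. *)
have J_var i : J ('X_i - 'X_(s' i)).
  rewrite -(subrKA 'X_(s i)); apply: ideal_genD.
    by apply: stJ; rewrite /stage /= rmorphB /= !substXU ss subrr; apply: mon_ideal0.
  rewrite /s' /= /glue; case: eqP => [->|_]; last by rewrite subrr; apply: ideal_gen0.
  rewrite (_ : 'X_a - 'X_a0 = (- 1) * ('X_a0 - 'X_a)); last by ring.
  by apply: ideal_genM; apply: sub_ideal_gen; right.
have J_mon u : J ('X_[u] - subst s' 'X_[u]).
  elim/mnm_ind: u => [|u i IHu]; first by rewrite mpolyX0 rmorph1 subrr; apply: ideal_gen0.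
  rewrite mpolyXD rmorphM /= substXU.
  rewrite (_ : _ - _ = 'X_[u] * ('X_i - 'X_(s' i)) + 'X_(s' i) * ('X_[u] - subst s' 'X_[u])).
    by apply: ideal_genD; apply: ideal_genM; [apply: J_var | apply: IHu].
  by ring.
have J_sub f : J (f - subst s' f).
  rewrite substE {1}(mpolyE f) -sumrB; apply: (big_ind J) => [||u _].
  - exact: ideal_gen0.
  - exact: ideal_genD.
  rewrite -substX -scalerBr -mul_mpolyC; apply: ideal_genM; exact: J_mon.
move=> Qg; rewrite -(subrK (subst s' g) g); apply: ideal_genD; first exact: J_sub.
apply: ideal_closed_mon => [||f h|v /Qg[u Uu uv]].
- exact: ideal_gen0.
- exact: ideal_genD.
- exact: ideal_genM.
rewrite -(submK uv) mpolyXD -substX; apply: ideal_genM.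
rewrite -[subst _ _](subKr 'X_[u]); apply: JB => //; apply: stJ.
by rewrite /stage /= substX; apply/mon_idealX; exists u => //; apply: lepm_refl.
Qed.

End Identification.

(** * A regular sequence of differences of variables *)

Section DepthLowerBound.
Variables (K : fieldType) (n : nat).
Local Notation R := {mpoly K[n]}.
Implicit Types (U V : set 'X_{1..n}) (u v w : 'X_{1..n}) (f g : R) (l : seq 'I_n).

Definition mix (X : pred 'I_n) u v : 'X_{1..n} :=
  [multinom if X i then u i else v i | i < n].

Definition merge (a0 : 'I_n) l i : 'I_n := if i \in l then a0 else i.

Variables (U : set 'X_{1..n}) (r : 'I_n -> 'I_n) (a0 : 'I_n).
Hypotheses (upU : upward U) (U0 : ~ U 0%MM).
Hypothesis mixU : forall l u v, U u -> U v -> U (mix (fun i => r i \in l) u v).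

(** Identifying the variables [l] with [a0] keeps the ideal an intersection of
    one ideal in the variables of the parts already touched and one in the
    remaining variables. *)
Lemma image_up_merge l v : {in l, forall a, r a = a} -> r a0 = a0 ->
  image_up (merge a0 l) U v <->
  (exists2 u, U u & forall i, r i \in a0 :: l -> (mapm (merge a0 l) u i <= v i)%N) /\
  (exists2 u, U u & forall i, r i \notin a0 :: l -> (mapm (merge a0 l) u i <= v i)%N).
Proof.
move=> rl ra0; split=> [[u Uu /mnm_lepP uv]|[[u1 Uu1 le1] [u2 Uu2 le2]]].
  by split; exists u.
exists (mix (fun i => r i \in a0 :: l) u1 u2); first exact: mixU.
apply/mnm_lepP => i; case rX: (r i \in a0 :: l).
  apply: leq_trans (le1 i rX); rewrite !mapmE; apply: leq_sum => j /eqP eji.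
  rewrite mnmE; suff -> : r j \in a0 :: l by [].
  move: eji; rewrite /merge; case: ifP => [jl _|_ ->//].
  by rewrite rl // inE jl orbT.
apply: leq_trans (le2 i (negbT rX)); rewrite !mapmE; apply: leq_sum => j /eqP eji.
rewrite mnmE; suff -> : r j \in a0 :: l = false by [].
move: eji; rewrite /merge; case: ifP => [_ eji|_ ->//].
by rewrite -eji ra0 mem_head in rX.
Qed.

(** The difference [x_a0 - x_a] is regular modulo each of the two ideals of
    [image_up_merge], since one does not involve [x_a] and the other does not
    involve [x_a0]. *)
Lemma stage_regular l a g : {in l, forall a, r a = a} -> r a0 = a0 -> r a = a ->
  a \notin a0 :: l ->
  stage U (merge a0 l) (('X_a0 - 'X_a) * g) -> stage U (merge a0 l) g.
Proof.
move=> rl ra0 ra al; rewrite /stage /= rmorphM rmorphB /= !substXU.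
have aN : a \notin l by apply: contra al; rewrite inE orbC => ->.
have aa0 : a0 != a by apply: contraNneq al => ->; rewrite mem_head.
have -> : merge a0 l a0 = a0 by rewrite /merge; case: ifP.
have -> : merge a0 l a = a by rewrite /merge (negbTE aN).
move: (subst _ g) => {}g.
set V := image_up _ _ => Vg.
have VE := fun v => image_up_merge v rl ra0.
pose V1 := [set v | exists2 u, U u &
  forall i, r i \in a0 :: l -> (mapm (merge a0 l) u i <= v i)%N].
pose V2 := [set v | exists2 u, U u &
  forall i, r i \notin a0 :: l -> (mapm (merge a0 l) u i <= v i)%N].
have g1 : mon_ideal V1 g.
  apply: (@diff_regular _ _ _ a0 a) => //; last by move=> u /Vg /VE[].
    move=> u v [w Uw wu] /mnm_lepP uv; exists w => // i ri.
    exact: leq_trans (wu i ri) (uv i).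
  move=> u [w Uw wu]; exists w => // i ri; apply: leq_trans (wu i ri) _.
  rewrite mnmDE mnm1E; case: eqP => [ai|_]; last by rewrite addn0.
  by move: ri; rewrite -ai ra (negbTE al).
have g2 : mon_ideal V2 g.
  apply: (@diff_regular _ _ _ a a0); rewrite 1?eq_sym //.
  - move=> u v [w Uw wu] /mnm_lepP uv; exists w => // i ri.
    exact: leq_trans (wu i ri) (uv i).
  - move=> u [w Uw wu]; exists w => // i ri; apply: leq_trans (wu i ri) _.
    rewrite mnmDE mnm1E; case: eqP => [ai|_]; last by rewrite addn0.
    by move: ri; rewrite -ai ra0 mem_head.
  rewrite -opprB mulNr -scaleN1r; apply: mon_idealZ => u /Vg /VE[] //.
by move=> u ug; apply/VE; split; [apply: g1 | apply: g2].
Qed.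

Lemma stage_proper l : ~ stage U (merge a0 l) (1 : R).
Proof.
rewrite /stage /= rmorph1 -mpolyX0 => /mon_idealX[u Uu /mnm_lepP u0]; apply: U0.
suff <- : u = 0%MM by [].
apply/mnmP => j; have := u0 (merge a0 l j); rewrite mapmE !mnm0E leqn0 sum_nat_eq0.
by move=> /forallP/(_ j); rewrite eqxx => /eqP.
Qed.

Lemma regular_stage l1 l2 : uniq (a0 :: l1 ++ l2) ->
  {in a0 :: l1 ++ l2, forall a, r a = a} ->
  regular_seq (stage U (merge a0 l1)) [seq 'X_a0 - 'X_a : R | a <- l2].
Proof.
elim: l2 l1 => [|a l2 IHl] l1 ul ra /=; first exact: stage_proper.
have al : a \notin l1.
  by move: ul; rewrite /= cat_uniq /= => /and4P[_ _ /norP[]].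
have a0a : a0 != a.
  by move: ul; rewrite /= mem_cat inE !negb_or => /andP[/and3P[_ -> _] _].
have ra0 : r a0 = a0 by apply: ra; rewrite mem_head.
have raa : r a = a by apply: ra; rewrite inE mem_cat mem_head !orbT.
have rl1 : {in l1, forall b, r b = b}.
  by move=> b bl; apply: ra; rewrite inE mem_cat bl orbT.
split=> [g|].
  by apply: stage_regular; rewrite // inE negb_or eq_sym a0a.
have ma0 : merge a0 l1 a0 = a0 by rewrite /merge; case: ifP.
rewrite stage_glue //; last 2 first.
- by move=> i; rewrite {2}/merge; case: ifP => // il; rewrite ma0 /merge il.
- by rewrite /merge (negbTE al).
have -> : glue a0 a \o merge a0 l1 = merge a0 (rcons l1 a).
  apply/funext => i; rewrite /= /glue /merge mem_rcons inE.
  by case: (boolP (i \in l1)); rewrite ?orbT ?(negbTE a0a) // orbF.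
by apply: IHl; rewrite cat_rcons.
Qed.

Lemma regular_seq_exists l : uniq (a0 :: l) -> {in a0 :: l, forall a, r a = a} ->
  exists fs : seq R, [/\ size fs = size l, forall f, f \in fs -> irrelevant f &
    regular_seq (mon_ideal U) fs].
Proof.
move=> ul rl; exists [seq 'X_a0 - 'X_a | a <- l]; split; first by rewrite size_map.
  move=> f /mapP[a _ ->].
  have m_var i : irrelevant ('X_i : R) by apply: sub_ideal_gen; exists i.
  apply: ideal_genD; first exact: m_var.
  by rewrite -mulN1r; apply: ideal_genM; apply: m_var.
have <- : stage U (merge a0 [::]) = mon_ideal U :> set R.
  apply/seteqP; split=> g; rewrite /stage /= (subst_id g).
    move=> Ug u /Ug[w Uw wu]; apply: upU Uw _.
    by move: wu; rewrite (_ : mapm _ w = w) //; apply/mnmP => i; rewrite mapmE (big_pred1 i).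
  move=> Ug u /Ug Uu; exists u => //.
  by rewrite (_ : mapm _ u = u) ?lepm_refl //; apply/mnmP => i; rewrite mapmE (big_pred1 i).
exact: (@regular_stage [::]).
Qed.

End DepthLowerBound.

(** * The depth of the powers *)

Section DepthPowers.
Variables (K : fieldType) (n d : nat) (I : set {mpoly K[n]}).
Implicit Types (S A B C : {set 'I_n}) (u v w : 'X_{1..n}).
Hypotheses (mI : matroidal I) (dI : gens_degree I d).
Local Notation Bs := (bases I).
Hypothesis loopless : forall i, exists2 B, B \in Bs & i \in B.
Variable B : {set 'I_n}.
Hypothesis Bb : B \in Bs.

Definition adj x y := edge Bs B x y || edge Bs B y x.

Lemma adj_sym : connect_sym adj.
Proof. by apply: sym_connect_sym => x y; rewrite /adj orbC. Qed.

Definition comp_root := fingraph.root adj.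

Definition component a : {set 'I_n} := [set i | comp_root i == a].

Lemma adj_root x y : adj x y -> comp_root x = comp_root y.
Proof. by move=> xy; apply/eqP; rewrite (root_connect adj_sym) connect1. Qed.

Lemma comp_root_idem x : comp_root (comp_root x) = comp_root x.
Proof. exact: (root_root adj_sym). Qed.

Lemma minimal_setT B' : B' \in Bs -> minimal Bs [set: 'I_n] B'.
Proof.
by move=> B'b; split=> // B2 B2b; rewrite !setIT (card_base dI B'b) (card_base dI B2b).
Qed.

Lemma unlinked_union (P : pred 'I_n) :
  unlinked Bs B [set i | P (comp_root i)] ([set: 'I_n] :\: [set i | P (comp_root i)]).
Proof.
move=> x y; rewrite !inE andbT => Px Py; split; apply: contra Py => e.
  by rewrite -(@adj_root x y) // /adj e.
by rewrite -(@adj_root x y) // /adj e orbT.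
Qed.

Lemma card_component a B' : B' \in Bs -> #|B' :&: component a| = #|B :&: component a|.
Proof.
move=> B'b; apply: (unlinked_card (bases_exchange mI) (minimal_setT Bb)).
- exact: subsetT.
- exact: (@unlinked_union (pred1 a)).
exact: minimal_setT.
Qed.

Lemma linked_component a : linked Bs B (component a).
Proof.
move=> X ltX X0; apply: contrapT => noedge.
have [_ [y yC yX]] := properP ltX; have [x xX] := set0Pn _ X0.
have xC := subsetP (proper_sub ltX) x xX.
have /closed_connect clX : closed adj (mem X).
  apply: (intro_closed adj_sym) => u v uv uX; apply: contrapT => /negP vX.
  apply: noedge; exists u, v; split=> //; rewrite inE vX inE -(adj_root uv) /=.
  by have := subsetP (proper_sub ltX) u uX; rewrite inE.
have := clX x y; rewrite -(root_connect adj_sym).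
by move: xC yC; rewrite !inE /comp_root => /eqP-> /eqP->; rewrite eqxx xX (negbTE yX) => /(_ isT).
Qed.

(** Recombination makes [I^t] an intersection of ideals in the variables of
    the single components. *)
Lemma multiples_mix t (l : seq 'I_n) u v : multiples I t u -> multiples I t v ->
  multiples I t (mix (fun i => comp_root i \in l) u v).
Proof.
move=> [u1 bu1 /mnm_lepP le1] [v1 bv1 /mnm_lepP le2].
have sub : {subset Bs <= minimals Bs [set: 'I_n]}.
  by move=> S Sb; apply/minimalsP; apply: minimal_setT.
have [w [bw wu wv]] := base_sum_combine (bases_exchange mI) (minimal_setT Bb)
  (subsetT _) (@unlinked_union (mem l)) (base_sum_sub sub bu1) (base_sum_sub sub bv1).
exists w; first exact: base_sum_sub (@minimals_sub _ _ _) bw.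
apply/mnm_lepP => i; rewrite mnmE; case: ifP => il.
  by rewrite wu ?inE.
by rewrite wv ?inE ?il.
Qed.

Definition comp_roots := [seq i <- enum 'I_n | comp_root i == i].

Lemma comp_roots_uniq : uniq comp_roots.
Proof. exact: filter_uniq (enum_uniq _). Qed.

Lemma mem_comp_roots i : (i \in comp_roots) = (comp_root i == i).
Proof. by rewrite mem_filter mem_enum andbT. Qed.

(** The product over all components of the monomials of [linked_socle]. The
    numbers of factors add up to [#|B| = d], which is where the bound [d]
    comes from; copies of [B] raise it to [t]. *)
Lemma socle_exists t : (d <= t)%N -> exists w, forall s,
  multiples I t (mshift w s) <->
  forall a, a \in comp_roots -> has (fun j => comp_root j == a) s.
Proof.
move=> dt.
have /choice[wa waP] : forall a, exists w, a \in comp_roots ->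
    forall i, i \in component a -> base_sum Bs #|B :&: component a| (w + U_(i))%MM.
  move=> a; have [aR|] := boolP (a \in comp_roots); last by exists 0%MM.
  have [B' B'b aB'] := loopless a.
  have [b] : exists b, b \in B :&: component a.
    apply/set0Pn; rewrite -card_gt0 -(card_component a B'b) card_gt0.
    by apply/set0Pn; exists a; rewrite !inE aB' -mem_comp_roots.
  rewrite inE => /andP[bB bC].
  have [w wP] := linked_socle Bb bB bC (@linked_component a).
  by exists w.
have sum_card : (\sum_(a <- comp_roots) #|B :&: component a|)%N = d.
  rewrite -(card_base dI Bb) -sum1_card /comp_roots big_filter big_enum_cond.
  rewrite [RHS](partition_big comp_root (fun a => comp_root a == a)) /=; last first.
    by move=> i _; rewrite comp_root_idem.
  apply: eq_bigr => a _; rewrite -sum1_card.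
  by apply: eq_bigl => i; rewrite !inE.
pose w := (\sum_(a <- comp_roots) wa a + mon B *+ (t - d))%MM.
have base_w (c : 'I_n -> 'I_n) : (forall a, a \in comp_roots -> comp_root (c a) = a) ->
    base_sum Bs t (w + \sum_(a <- comp_roots) U_(c a))%MM.
  move=> cP; have := @base_sum_big _ Bs _ comp_roots (fun a => #|B :&: component a|)
    (fun a => (wa a + U_(c a))%MM).
  rewrite sum_card big_split /= => H.
  have := base_sum_pad Bb dt (H _); rewrite -!addmA [(\sum_(a <- _) U_(_) + _)%MM]addmC !addmA.
  by apply=> a aR; apply: waP; rewrite ?inE ?cP.
exists w => s; split=> [[u bu us] a aR|hs].
  apply/negPn/negP => /hasPn none.
  (* On the component a, the monomial w has degree one less than any product
     of t bases. *)
  have := @deg_on_base_sum_ge _ Bs (component a) _ _ _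
    (fun S Sb => eq_leq (esym (card_component a Sb))) bu.
  move=> /leq_trans/(_ (leq_deg_on (component a) us)).
  have := @deg_on_base_sum _ Bs (component a) _ _ _ (card_component a) (@base_w id _).
  rewrite /mshift !deg_onD !deg_on_sum => <-; last by move=> b; rewrite mem_comp_roots => /eqP.
  rewrite leq_add2l [X in (_ <= X)%N]big_seq [X in (_ <= X)%N]big1 => [|j /none ja]; last first.
    by rewrite deg_on_var inE (negbTE ja).
  rewrite leqn0 sum_nat_seq_eq0 => /allP/(_ a aR) /=.
  by rewrite deg_on_var inE -mem_comp_roots aR.
have /choice[c cP] : forall a, exists j, a \in comp_roots -> (j \in s) && (comp_root j == a).
  move=> a; have [/hs/hasP[j js ja]|] := boolP (a \in comp_roots); last by exists a.
  by exists j; rewrite js.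
exists (w + \sum_(a <- comp_roots) U_(c a))%MM.
  by apply: base_w => a /cP/andP[_ /eqP].
apply/mnm_lepP => i; rewrite !mnmDE leq_add2l; move: i; apply/mnm_lepP.
rewrite -(big_map c xpredT (fun j => U_(j)%MM)); apply: sum_vars_le => [|j /mapP[a aR ->]].
  rewrite map_inj_in_uniq ?comp_roots_uniq // => a b aR bR cab.
  have /andP[_ /eqP <-] := cP a aR; have /andP[_ /eqP <-] := cP b bR.
  by rewrite cab.
by have /andP[] := cP a aR.
Qed.

Lemma depth_pow (n_gt0 : (0 < n)%N) t : (d <= t)%N ->
  depth (ideal_pow I t) = natE (size comp_roots).-1.
Proof.
move=> dt; rewrite ideal_powE //.
have d_gt0 : (0 < d)%N.
  have [B' B'b iB'] := loopless (Ordinal n_gt0).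
  by rewrite -(card_base dI B'b) card_gt0; apply/set0Pn; exists (Ordinal n_gt0).
have U0 : ~ multiples I t 0%MM.
  move=> [u bu /(leq_deg_on [set: 'I_n])].
  have cardT S : S \in Bs -> #|S :&: [set: 'I_n]| = d.
    by move=> Sb; rewrite setIT (card_base dI Sb).
  rewrite (deg_on_base_sum cardT bu) /deg_on big1 => [|i _]; last by rewrite mnm0E.
  by rewrite leqn0 muln_eq0 !eqn0Ngt d_gt0 (leq_trans d_gt0 dt).
have [w wP] := socle_exists dt.
have rR j : comp_root j \in comp_roots by rewrite mem_comp_roots comp_root_idem.
have rK : {in comp_roots, forall a, comp_root a = a}.
  by move=> a; rewrite mem_comp_roots => /eqP.
have uR := comp_roots_uniq.
case: comp_roots uR rK rR wP => [_ _ /(_ (Ordinal n_gt0))//|a0 l uR rK rR wP].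
apply: sup_nat_greatest => /= [|b [fs [<- fsm regfs]]].
  apply: (@regular_seq_exists K n _ comp_root a0 _ _ _ l) => //.
    exact: multiples_up.
  by move=> l' u v; apply: multiples_mix.
by apply: (regular_seq_bound _ uR rK rR wP fsm regfs); apply: multiples_up.
Qed.

End DepthPowers.

(** * Extremal values of sets of natural numbers *)

Lemma inf_nat_le (P : set nat) a : P a -> (inf_nat P <= natE a)%E.
Proof.
move=> Pa; have exP : exists k, `[< P k >] by exists a; apply/asboolP.
have [m /asboolP Pm minm] := ex_minnP exP.
rewrite (inf_nat_least Pm) ?le_natE; first by apply/minm/asboolP.
by move=> b Pb; apply/minm/asboolP.
Qed.

Lemma sup_nat_ge (P : set nat) a : P a -> (natE a <= sup_nat P)%E.
Proof.
move=> Pa; have [[m bm]|unb] := pselect (exists m, forall b, P b -> (b <= m)%N).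
  have exP : exists k, `[< P k >] by exists a; apply/asboolP.
  have bnd b : `[< P b >] -> (b <= m)%N by move/asboolP/bm.
  have [k /asboolP Pk maxk] := ex_maxnP exP bnd.
  rewrite (sup_nat_greatest Pk) ?le_natE; first by apply/maxk/asboolP.
  by move=> b Pb; apply/maxk/asboolP.
rewrite sup_nat_unbounded ?leey // => m; apply: contrapT => nob; apply: unb.
exists m => b Pb; rewrite leqNgt; apply/negP => mb; apply: nob.
by exists b => //; apply: ltnW.
Qed.

(** * A chain of primes in the fiber ring *)

Section FacePart.
Variables (K : fieldType) (n d : nat) (I : set {mpoly K[n]}).
Local Notation R := {mpoly K[n]}.
Local Notation Bs := (bases I).
Implicit Types (S B : {set 'I_n}) (u v w : 'X_{1..n}).
Hypotheses (mI : matroidal I) (dI : gens_degree I d).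

(** A product of [k] bases has degree [d k] and exponents at most [k]; equality
    at all [j] in [S] means that every factor contains [S]. *)
Definition on_face S k u := (mdeg u == d * k)%N && [forall (j | j \in S), u j == k].

Definition face_part S k (g : R) : R := \sum_(u <- msupp g | on_face S k u) g@_u *: 'X_[u].

Lemma mcoeff_face_part S k g u : (face_part S k g)@_u = if on_face S k u then g@_u else 0.
Proof.
rewrite /face_part raddf_sum /=.
have [ug|ug] := boolP (u \in msupp g); last first.
  rewrite (memN_msupp_eq0 ug) if_same big_seq_cond big1 // => v /andP[vg _].
  rewrite mcoeffZ mcoeffX; case: eqP => [vu|_]; last by rewrite mulr0.
  by rewrite -vu vg in ug.
case: ifP => fu.
  rewrite big_mkcond (bigD1_seq u) ?msupp_uniq //= fu mcoeffZ mcoeffX eqxx mulr1.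
  rewrite big1 ?addr0 // => v vu; case: ifP => // _.
  by rewrite mcoeffZ mcoeffX (negbTE vu) mulr0.
rewrite big1 // => v fv; rewrite mcoeffZ mcoeffX; case: eqP => [vu|_]; last by rewrite mulr0.
by rewrite -vu fv in fu.
Qed.

Lemma multiples_mdeg k u : multiples I k u -> (d * k <= mdeg u)%N /\
  (mdeg u = d * k -> forall j, u j <= k)%N.
Proof.
move=> [v [s [<- sB ->]] /mnm_lepP vu].
have szv : mdeg (\sum_(S <- s) mon S)%MM = (d * size s)%N.
  rewrite mdeg_sum big_seq (eq_bigr (fun=> d)) => [|S /sB Sb]; last first.
    by apply: dI; apply/basesP.
  by rewrite -big_seq big_const_seq count_predT iter_addn_0.
rewrite -szv; split=> [|eu j]; first by rewrite !mdegE leq_sum.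
have /eqP : u = (\sum_(S <- s) mon S)%MM.
  have /mnm_lepP uv := vu; rewrite -(submK uv); move/eqP: eu.
  rewrite -{1}(submK uv) mdegD -[X in _ == X]add0n eqn_add2r mdeg_eq0 => /eqP->.
  by rewrite add0m.
move/eqP->; rewrite mnm_sumE; elim: (s) => [|S s' IHs]; rewrite ?big_nil ?big_cons //=.
by rewrite mnmE -add1n leq_add // leq_b1.
Qed.

(** Both the degree and the bounds on the exponents are additive, so a product
    is extremal exactly when both factors are. *)
Lemma face_partM S k l (a b : R) : ideal_pow I k a -> ideal_pow I l b ->
  face_part S (k + l) (a * b) = face_part S k a * face_part S l b.
Proof.
rewrite !ideal_powE // => Ia Ib; apply/mpolyP => m.
rewrite mcoeff_face_part !mcoeffM.
transitivity (\sum_(p : 'X_{1..n < (mdeg m).+1, (mdeg m).+1} | m == (p.1 + p.2)%MM)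
   if on_face S (k + l) m then a@_p.1 * b@_p.2 else 0).
  by case: ifP => // _; rewrite big1.
apply: eq_bigr => -[[v vm] [w wm]] /= /eqP em; rewrite !mcoeff_face_part.
have [a0|] := eqVneq a@_v 0; first by rewrite a0 mul0r !if_same mul0r.
rewrite -mcoeff_msupp => /Ia/multiples_mdeg[dv vj].
have [b0|] := eqVneq b@_w 0; first by rewrite b0 mulr0 !if_same mulr0.
rewrite -mcoeff_msupp => /Ib/multiples_mdeg[dw wj].
suff -> : on_face S (k + l) m = on_face S k v && on_face S l w.
  by do 2 case: (on_face _ _ _); rewrite ?mul0r ?mulr0.
rewrite em /on_face mdegD mulnDr; apply/idP/idP => [/andP[/eqP ed /forall_inP ej]|].
  have ev : mdeg v = (d * k)%N by move: ed dv dw; clear; lia.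
  have ew : mdeg w = (d * l)%N by move: ed dv dw; clear; lia.
  rewrite ev ew !eqxx /=; apply/andP; split; apply/forall_inP => j jS;
    have /eqP := ej j jS; rewrite mnmDE; have := vj ev j; have := wj ew j; clear; lia.
move=> /andP[/andP[/eqP-> /forall_inP jv] /andP[/eqP-> /forall_inP jw]].
rewrite eqxx /=; apply/forall_inP => j jS.
by rewrite mnmDE (eqP (jv j jS)) (eqP (jw j jS)).
Qed.

Lemma face_partD S k (a b : R) : face_part S k (a + b) = face_part S k a + face_part S k b.
Proof.
apply/mpolyP => m; rewrite mcoeffD !mcoeff_face_part mcoeffD.
by case: ifP; rewrite ?addr0.
Qed.

Lemma face_part0 S k : face_part S k 0 = 0.
Proof. by rewrite /face_part msupp0 big_nil. Qed.

Definition face_map S (p : rees_alg I) : {poly R} :=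
  \poly_(k < size (rees_val p)) face_part S k (rees_val p)`_k.

Lemma coef_face_map S p k : (face_map S p)`_k = face_part S k (rees_val p)`_k.
Proof.
rewrite coef_poly; case: ltnP => // /(nth_default 0)->.
by rewrite face_part0.
Qed.

Lemma face_mapD S p q : face_map S (p + q) = face_map S p + face_map S q.
Proof.
by apply/polyP => k; rewrite coefD !coef_face_map /= coefD face_partD.
Qed.

Lemma face_mapM S p q : face_map S (p * q) = face_map S p * face_map S q.
Proof.
have /asboolP Ip := valP p; have /asboolP Iq := valP q.
apply/polyP => k; rewrite coefM !coef_face_map /= coefM.
rewrite (big_morph _ (face_partD S k) (face_part0 S k)); apply: eq_bigr => i _.
rewrite !coef_face_map -face_partM; [|exact: Ip|exact: Iq].
by rewrite subnKC // -ltnS.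
Qed.

Lemma face_map1 S : face_map S 1 != 0.
Proof.
have val1 : rees_val (1 : rees_alg I) = 1 by [].
suff one : (face_map S 1)`_0 = 1.
  by apply: contra_eqN one => /eqP->; rewrite coef0 eq_sym oner_eq0.
rewrite coef_face_map val1 coef1; apply/mpolyP => u.
rewrite mcoeff_face_part mcoeff1; case: eqP => [->|_]; last by rewrite if_same.
by rewrite /on_face mdeg0 muln0 eqxx ifT //; apply/forall_inP => j _; rewrite mnm0E.
Qed.

Lemma face_map_rees_m S p : p \in @rees_m K n I -> face_map S p = 0.
Proof.
move=> /asboolP mp; apply/polyP => k; rewrite coef_face_map coef0.
apply/mpolyP => u; rewrite mcoeff_face_part mcoeff0; case: ifP => // /andP[/eqP du _].
pose J : set R := [set g : R | forall v, v \in msupp g -> (d * k < mdeg v)%N].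
have J_up : forall a g, J g -> J (a * g).
  move=> a g Jg v /msuppM_le/allpairsP[[v1 v2] /= [_ /Jg lt ->]].
  by rewrite mdegD; apply: leq_trans lt (leq_addl _ _).
apply: memN_msupp_eq0; apply/negP => up.
suff /(_ _ (mp k) u up) : ideal_mul (@irrelevant K n) (ideal_pow I k) `<=` J by rewrite du ltnn.
apply: ideal_gen_min => [v|x y Jx Jy v|//|_ [a ma [b Ib ->]]].
- by rewrite msupp0.
- by move=> /msuppD_le; rewrite mem_cat => /orP[/Jx|/Jy].
move=> v /msuppM_le/allpairsP[[v1 v2] /= [v1a v2b ->]].
move: Ib; rewrite ideal_powE // => /(_ _ v2b)/multiples_mdeg[le2 _].
rewrite mdegD -add1n leq_add // lt0n mdeg_eq0; apply: contraTneq v1a => ->.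
by rewrite mcoeff_msupp (irrelevant_coef0 ma) eqxx.
Qed.

Local Notation to_fiber := (\pi_({ideal_quot (@rees_m K n I)})%qT).

Definition face_prime S : set (fiber_ring I) := [set x | face_map S (repr x) = 0].

Lemma face_map_repr S (p : rees_alg I) :
  face_map S (repr (to_fiber p)) = face_map S p.
Proof.
set q := repr _; have : q - p \in @rees_m K n I by rewrite Quotient.idealrBE reprK.
by move/(face_map_rees_m S) => qp; rewrite -(subrK p q) face_mapD qp add0r.
Qed.

Lemma face_primeE S (p : rees_alg I) :
  face_prime S (to_fiber p) <-> face_map S p = 0.
Proof. by rewrite /face_prime /= face_map_repr. Qed.

Lemma face_prime_prime S : prime_ideal (face_prime S).
Proof.
apply/prime_idealP; split=> [||a x y Px Py|x y].
- rewrite -(rmorph0 to_fiber); apply/face_primeE.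
  by apply/polyP => k; rewrite coef_face_map !coef0 face_part0.
- rewrite -(rmorph1 to_fiber) => /face_primeE.
  by apply/eqP/face_map1.
- move: Px Py; rewrite -[a]reprK -[x]reprK -[y]reprK => /face_primeE Px /face_primeE Py.
  by rewrite -rmorphM -rmorphD; apply/face_primeE; rewrite face_mapD face_mapM Px Py mulr0 addr0.
rewrite -[x]reprK -[y]reprK -rmorphM => /face_primeE; rewrite face_mapM => /eqP.
by rewrite mulf_eq0 => /orP[]/eqP ?; [left|right]; apply/face_primeE.
Qed.

Lemma face_prime_sub S S' : S \subset S' -> face_prime S `<=` face_prime S'.
Proof.
move=> /subsetP SS' x Sx; apply/polyP => k; rewrite coef_face_map coef0.
have := congr1 (fun p : {poly R} => p`_k) Sx; rewrite coef_face_map coef0 => Sk.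
apply/mpolyP => u; rewrite mcoeff_face_part mcoeff0; case: ifP => // /andP[du /forall_inP fu].
have /mpolyP/(_ u) := Sk; rewrite mcoeff_face_part mcoeff0 ifT // /on_face du.
by apply/forall_inP => j /SS' /fu.
Qed.

Lemma base_in_rees B : B \in Bs -> ('X_[mon B] : R) *: 'X \in rees I.
Proof.
move=> Bb; apply/asboolP => k; rewrite coefZ coefX.
case: eqP => [->|_]; last by rewrite mulr0; apply: ideal_pow0.
rewrite mulr1 ideal_powE //; apply/mon_idealX.
by exists (mon B); [apply: base_sum1 | apply: lepm_refl].
Qed.

(** The basis [B], as an element of degree 1 of the Rees algebra, lies on the
    face of [S] but not on that of [b |: S]. *)
Lemma face_prime_proper S b B : B \in Bs -> S \subset B -> b \notin B ->
  face_prime S `<` face_prime (b |: S).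
Proof.
move=> Bb SB bB; split; first by apply: face_prime_sub; apply: subsetUr.
pose p := ReesAlg (base_in_rees Bb).
move=> /(_ (to_fiber p)) sub.
have : face_prime S (to_fiber p).
  apply: sub; apply/face_primeE/polyP => k; rewrite coef_face_map coef0 /= coefZ coefX.
  case: eqP => [->|_]; last by rewrite mulr0 face_part0.
  rewrite mulr1; apply/mpolyP => u; rewrite mcoeff_face_part mcoeff0 mcoeffX.
  case: ifP => // /andP[_ /forall_inP fu]; case: eqP => // eu.
  by have := fu b; rewrite !inE eqxx -eu mnmE (negbTE bB) => /(_ isT).
move/face_primeE/polyP/(_ 1%N); rewrite coef_face_map coef0 /= coefZ coefX mulr1.
move=> /mpolyP/(_ (mon B)); rewrite mcoeff_face_part mcoeff0 mcoeffX eqxx ifT.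
  by move/eqP; rewrite oner_eq0.
rewrite /on_face muln1; apply/andP; split; first by apply/eqP/dI/basesP.
by apply/forall_inP => j /(subsetP SB) jB; rewrite mnmE jB.
Qed.

(** If [b] is the next element of the enumeration of [B], a basis that avoids
    [b] provides an exchange [B - b + y] that keeps the segment before [b]. *)
Lemma analytic_spread_ge B : B \in Bs ->
  (forall i, exists2 B', B' \in Bs & i \notin B') -> (natE d <= analytic_spread I)%E.
Proof.
move=> Bb coloopless; apply: sup_nat_ge.
pose S i := [set x in take i (enum B)].
exists (fun i => face_prime (S i)); split=> i lt_id; first exact: face_prime_prime.
have szB : size (enum B) = d by rewrite -cardE (card_base dI Bb).
have [b0 _] : exists b, b \in B.
  by apply/set0Pn; rewrite -card_gt0 (card_base dI Bb); case: (d) lt_id.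
pose b := nth b0 (enum B) i.
have bB : b \in B by rewrite -mem_enum mem_nth ?szB.
have -> : S i.+1 = b |: S i.
  apply/setP => x; rewrite !inE (take_nth b0) ?szB // mem_rcons inE.
  by [].
have [B' B'b bB'] := coloopless b.
have [y [yB' yB swb]] := bases_exchange mI Bb B'b bB bB'.
apply: (face_prime_proper swb).
  apply/subsetP => x; rewrite !inE => xS; apply/orP; right.
  rewrite -(mem_enum B) (mem_take xS) andbT; apply: contraTneq xS => ->.
  have := enum_uniq B; rewrite -{1}(cat_take_drop i (enum B)) cat_uniq.
  rewrite (drop_nth b0) ?szB //= => /and3P[_ /norP[bi _] _]; exact: bi.
by rewrite !inE eqxx orbF; apply: contraNneq yB => <-.
Qed.

End FacePart.

(** * Stability indices *)

Import mathcomp.classical.classical_sets.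

Theorem corollary1p10 (K : fieldType) (n : nat) (n_gt0 : (0 < n)%N)
    (I : set {mpoly K[n]}) (d : nat)
    (I_matroidal : matroidal I) (I_degree : gens_degree I d)
    (I_gcd : gcd_gens I 0%MM) (I_supp : supp I = setT) :
  (astab I <= Order.min (natE d) (analytic_spread I))%E /\
  (dstab I <= Order.min (natE d) (analytic_spread I))%E.
Proof.
have loopless i : exists2 B, B \in bases I & i \in B.
  have [u Iu ui] : supp I i by rewrite I_supp.
  have [B eu Bb] := min_gens_mon I_matroidal Iu; exists B => //.
  by move: ui; rewrite /= eu mnmE lt0b.
have coloopless i : exists2 B, B \in bases I & i \notin B.
  apply: contrapT => coloop; have [_ gcd_max] := I_gcd.
  have /mnm_lepP/(_ i) : (U_(i) <= 0)%MM; last first.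
    by rewrite mnm1E eqxx mnm0E.
  apply: gcd_max => u /(min_gens_mon I_matroidal)[B -> Bb].
  rewrite lep1mP mnmE eqb0 negbK; apply: contrapT => /negP iB.
  by apply: coloop; exists B.
have [B Bb iB] := loopless (Ordinal n_gt0).
have d_gt0 : (0 < d)%N.
  by rewrite -(card_base I_degree Bb) card_gt0; apply/set0Pn; exists (Ordinal n_gt0).
have d_le := analytic_spread_ge I_matroidal I_degree Bb coloopless.
have stab_le m : (m <= natE d)%E -> (m <= Order.min (natE d) (analytic_spread I))%E.
  by move=> md; rewrite le_min md (le_trans md d_le).
split; apply: stab_le; apply: inf_nat_le; split=> // t dt.
  by apply/seteqP; split; apply: (Ass_pow_sub I_matroidal I_degree Bb).
by rewrite !(depth_pow I_matroidal I_degree loopless Bb n_gt0).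
Qed.
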